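(* Let $u\in L^1(X,\nu)$ and let $z\in X$ be such that $R^*z\neq 0$ and $u\,v_z\in L^1(X,\nu)$. Then $u\in BV_z(X,\nu)$ if and only if $V_z(u)<+\infty$. In this case the measure $m_z$ from the definition of $BV_z(X,\nu)$ satisfies $|m_z|(X)=V_z(u)$.
   Context: $X$ is a separable real Hilbert space with inner product $\langle\cdot,\cdot\rangle$ and norm $\|\cdot\|$, $\nu$ is a Borel probability measure on $X$, and $R\in\mathcal L(X)$ is a bounded linear operator. $C^1_b(X)$ is the space of bounded, continuously Fréchet differentiable functions $\varphi:X\to\mathbb R$ with bounded gradient $\nabla\varphi$. Standing assumption: for every $z\in X$ there exists $v_z\in\bigcap_{p>1}L^p(X,\nu)$ such that $\int_X\langle R\nabla\varphi,z\rangle\,d\nu=\int_X v_z\varphi\,d\nu$ for all $\varphi\in C^1_b(X)$. For $z\in X$ and $\varphi\in C^1_b(X)$ set $\partial_z^*\varphi:=\langle R\nabla\varphi,z\rangle-v_z\varphi$. For $u\in L^1(X,\nu)$ with $uv_z\in L^1(X,\nu)$ define $V_z(u):=\sup\{\int_X u\,\partial_z^*\varphi\,d\nu:\ \varphi\in C^1_b(X),\ \|\varphi\|_\infty\le 1\}$. Such a $u$ belongs to $BV_z(X,\nu)$ if there exists a real (finite, countably additive) Borel measure $m_z$ on $X$ with $\int_X u\,\partial_z^*\varphi\,d\nu=-\int_X\varphi\,dm_z$ for all $\varphi\in C^1_b(X)$. For a real Borel measure $m$, $|m|(X)$ denotes its total variation. *)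

(* Defs.v *)
From HB Require Import structures.
From mathcomp Require Import all_boot all_order all_algebra.
From mathcomp Require Import all_classical all_reals all_analysis.
Set Implicit Arguments. Unset Strict Implicit. Unset Printing Implicit Defensive.
Import Order.TTheory GRing.Theory Num.Theory.
Import numFieldNormedType.Exports.
Local Open Scope classical_set_scope.
Local Open Scope ring_scope.

Definition is_inner_product (R : realType) (X : normedModType R)
  (ip : X -> X -> R) : Prop :=
  [/\ forall x y, ip x y = ip y x,
      forall (a : R) (x y w : X), ip (a *: x + y) w = a * ip x w + ip y w
    & forall x, ip x x = `|x| ^+ 2].

Definition separable (X : topologicalType) : Prop :=
  exists D : set X, countable D /\ closure D = [set: X].

Definition borelX (X : topologicalType) := g_sigma_algebraType (@open X).

Definition C1b_grad (R : realType) (X : normedModType R) (ip : X -> X -> R)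
  (phi : X -> R) (g : X -> X) : Prop :=
  [/\ exists M : R, forall x, `|phi x| <= M,
      forall x, differentiable phi x /\ forall h, 'd phi x h = ip (g x) h,
      continuous g
    & exists M : R, forall x, `|g x| <= M].

Definition in_Lp d (T : measurableType d) (R : realType)
  (nu : {measure set T -> \bar R}) (p : R) (f : T -> R) : Prop :=
  measurable_fun [set: T] f /\
  nu.-integrable [set: T] (fun x => (`|f x| `^ p)%:E).

Definition charge_integral d (T : measurableType d) (R : realType)
  (m : {charge set T -> \bar R}) (f : T -> R) : \bar R :=
  let PN := cid (Hahn_decomposition m) in
  let NN := cid (svalP PN) in
  (\int[jordan_pos (svalP NN)]_x (f x)%:E -
   \int[jordan_neg (svalP NN)]_x (f x)%:E)%E.

Definition charge_total_variation d (T : measurableType d) (R : realType)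
  (m : {charge set T -> \bar R}) : \bar R :=
  let PN := cid (Hahn_decomposition m) in
  let NN := cid (svalP PN) in
  charge_variation (svalP NN) [set: T].

Section BV.
Context (R : realType) (X : normedModType R) (ip : X -> X -> R)
  (nu : {measure set borelX X -> \bar R}) (Rop : X -> X) (v : X -> X -> R).

Definition dstar (z : X) (phi : X -> R) (g : X -> X) : X -> R :=
  fun x => ip (Rop (g x)) z - v z x * phi x.

Definition Vz (z : X) (u : X -> R) : \bar R :=
  ereal_sup [set r : \bar R | exists phi g,
    [/\ C1b_grad ip phi g, (forall x, `|phi x| <= 1) &
        r = (\int[nu]_x (u x * dstar z phi g x)%:E)%E]].

Definition BVz_measure (z : X) (u : X -> R)
  (m : {charge set borelX X -> \bar R}) : Prop :=
  forall phi g, C1b_grad ip phi g ->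
    (\int[nu]_x (u x * dstar z phi g x)%:E = - charge_integral m phi)%E.

Definition BVz (z : X) (u : X -> R) : Prop :=
  nu.-integrable [set: borelX X] (fun x => (u x)%:E) /\
  nu.-integrable [set: borelX X] (fun x => (u x * v z x)%:E) /\
  exists m, BVz_measure z u m.
End BV.

(* Main.v *)
(** Write [h = R^* z], so that [<R grad f, z> = D_h f], and let [L f] be the
    integral of [u (D_h f - v_z f)].  If [V_z(u)] is finite, [L] is bounded for the
    sup norm, and so is [D f], the integral of [u D_h f].  The point is to see
    that [L] is a measure although [X] need not be locally compact.

    Tightness.  If [f_n] decreases pointwise to [0] then [D theta] tends to [0]
    uniformly in [|theta| <= f_n].  Indeed let [phi] nearly attain the norm of [D].
    Replacing [phi] by its averages over short segments [[x, x + e h]] changes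
    [D phi] little and turns [D] into the integral of [u (phi(x + e h) - phi(x)) / e],
    which only sees [phi] up to sets of small [|u| nu]-measure; so [phi] can be cut
    off where [f_n] is not small.  The result and [theta] have essentially disjoint
    supports, so [|D theta|] is at most the small defect of [phi].

    By Riesz decomposition [L] is then a difference of two positive functionals on
    [C^1_b] that are continuous along sequences decreasing to [0], and each of
    them is represented by a finite measure, constructed as a Caratheodory
    extension in the manner of Daniell; separability makes the balls generate the
    Borel sets.

    For the total variation, indicators of Borel sets are L^1-limits of [C^1_b]
    functions with values in [[0, 1]]; approximating the positive set of a Hahn
    decomposition of [m_z] gives [|m_z|(X) <= V_z(u)]. *)

Require Import Defs.
From HB Require Import structures.
From mathcomp Require Import all_boot all_order all_algebra.
From mathcomp Require Import all_classical all_reals all_analysis.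
From mathcomp Require Import measurable_realfun ring lra.
Import Order.TTheory GRing.Theory Num.Theory.
Import numFieldNormedType.Exports.
Local Open Scope classical_set_scope.
Local Open Scope ring_scope.

Set Implicit Arguments.
Unset Strict Implicit.

(** * Gradients in an inner product space *)

Section inner_product.
Context {R : realType} {X : normedModType R} {ip : X -> X -> R}.
Hypothesis hip : is_inner_product ip.

Lemma ipC x y : ip x y = ip y x. Proof. by case: hip. Qed.

Lemma ipxx x : ip x x = `|x| ^+ 2. Proof. by case: hip. Qed.

Lemma ipDl x y w : ip (x + y) w = ip x w + ip y w.
Proof. by case: hip => _ /(_ 1 x y w) + _; rewrite scale1r mul1r. Qed.

Lemma ip0l w : ip 0 w = 0.
Proof. by apply: (@addrI _ (ip 0 w)); rewrite -ipDl !addr0. Qed.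

Lemma ipZl a x w : ip (a *: x) w = a * ip x w.
Proof. by case: hip => _ /(_ a x 0 w) + _; rewrite addr0 ip0l addr0. Qed.

Lemma ipBl x y w : ip (x - y) w = ip x w - ip y w.
Proof. by rewrite ipDl -scaleN1r ipZl mulN1r. Qed.

Lemma ipDr x y w : ip w (x + y) = ip w x + ip w y.
Proof. by rewrite ipC ipDl ipC (ipC y). Qed.

Lemma ipZr a x w : ip w (a *: x) = a * ip w x.
Proof. by rewrite ipC ipZl ipC. Qed.

Lemma ip0r w : ip w 0 = 0. Proof. by rewrite ipC ip0l. Qed.

(** Cauchy-Schwarz: the residual of [x] after projection onto the line of [y] has a nonnegative
    square norm. *)
Lemma ip_sqr_norm_le x y : ip x y ^+ 2 <= `|x| ^+ 2 * `|y| ^+ 2.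
Proof.
have [->|y0] := eqVneq y 0.
  by rewrite ip0r normr0 expr0n/= mulr0.
have ny : 0 < `|y| ^+ 2 by rewrite exprn_gt0 // normr_gt0.
have : 0 <= ip (x - (ip x y / `|y| ^+ 2) *: y) (x - (ip x y / `|y| ^+ 2) *: y).
  by rewrite ipxx sqr_ge0.
rewrite -scaleNr !(ipDl, ipDr, ipZl, ipZr) !ipxx (ipC y x).
set a := ip x y; set N := `|y| ^+ 2 in ny *; set M := `|x| ^+ 2.
have -> : M + - (a / N) * a + (- (a / N) * a + - (a / N) * (- (a / N) * N)) =
  (M * N - a ^+ 2) / N by field; apply: lt0r_neq0.
by rewrite pmulr_lge0 ?invr_gt0// subr_ge0.
Qed.

Lemma ip_norm_le x y : `|ip x y| <= `|x| * `|y|.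
Proof.
rewrite -(@ler_pXn2r _ 2)// ?nnegrE ?mulr_ge0//.
by rewrite exprMn -normrX ger0_norm ?sqr_ge0// ip_sqr_norm_le.
Qed.

Lemma continuous_ipl w : continuous (ip^~ w).
Proof.
move=> x; apply/cvgrPdist_le => e e0.
near=> t.
rewrite -ipBl; apply: le_trans (ip_norm_le _ _) _.
have : `|x - t| <= e / (`|w| + 1).
  near: t; apply: cvgr_dist_le => //.
  by rewrite divr_gt0// ltr_wpDl.
move=> /(ler_wpM2r (normr_ge0 w)) /le_trans; apply.
rewrite mulrAC ler_pdivrMr ?ltr_wpDl//.
by rewrite ler_pM2l// lerDl.
Unshelve. all: by end_near. Qed.

Definition grad (phi : X -> R) (g : X -> X) :=
  forall x, differentiable phi x /\ forall h, 'd phi x h = ip (g x) h.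

Lemma grad_comp (F F' : R -> R) phi g : grad phi g ->
  (forall x, is_derive (phi x) 1 F (F' (phi x))) ->
  grad (F \o phi) (fun x => F' (phi x) *: g x).
Proof.
move=> gphi dF x; have [dphi phiE] := gphi x; have dFx := dF x.
have dFd : differentiable F (phi x) by apply/derivable1_diffP; exact: ex_derive.
split; first exact: differentiable_comp.
move=> h; rewrite diff_comp//= phiE deriv1E//=.
by rewrite derive1E derive_val ipZl mulrC.
Qed.

Lemma grad_cst a : grad (cst a) (cst 0).
Proof. by move=> x; split; [exact: differentiable_cst|move=> h; rewrite diff_cst ip0l]. Qed.

Lemma gradD f g gf gg : grad f gf -> grad g gg -> grad (f \+ g) (gf \+ gg).
Proof.
move=> hf hg x; have [df fE] := hf x; have [dg gE] := hg x; split.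
  exact: differentiableD.
by move=> h; have -> : 'd (f \+ g) x h = 'd f x h + 'd g x h := congr1 (@^~ h) (diffD df dg); rewrite fE gE ipDl.
Qed.

Lemma gradM f g gf gg : grad f gf -> grad g gg ->
  grad (f \* g) (fun x => f x *: gg x + g x *: gf x).
Proof.
move=> hf hg x; have [df fE] := hf x; have [dg gE] := hg x; split.
  exact: differentiableM.
by move=> h; have -> : 'd (f \* g) x h = f x * 'd g x h + g x * 'd f x h := congr1 (@^~ h) (diffM df dg); rewrite fE gE ipDl !ipZl.
Qed.

Lemma grad_shift f gf c : grad f gf ->
  grad (fun x => f (x + c)) (fun x => gf (x + c)).
Proof.
move=> hf x; have [df fE] := hf (x + c).
have dsh : differentiable (fun y : X => y + c) x.
  by apply: differentiableD => //; exact: differentiable_cst.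
split.
  by apply: (@differentiable_comp _ _ _ _ (fun y => y + c) f).
move=> h; rewrite (@diff_comp _ _ _ _ (fun y => y + c) f)//=.
rewrite fE; congr (ip _ _).
have -> : 'd (fun y : X => y + c) x h = 'd id x h + 'd (cst c) x h.
  have did : differentiable (id : X -> X) x by [].
  exact: (congr1 (@^~ h) (diffD did (differentiable_cst c x))).
have -> : 'd (cst c) x h = 0 :> X by rewrite diff_cst.
rewrite addr0.
by have -> : 'd id x h = h := congr1 (@^~ h) (diff_val (is_diff_def := is_diff_id x)).
Qed.

(** The remainder of the first-order expansion is exactly [|h| ^+ 2], which is [o(h)]; [diff_unique]
    then identifies the differential. *)
Lemma grad_sqr_dist c : grad (fun x => `|x - c| ^+ 2) (fun x => 2 *: (x - c)).
Proof.
move=> x.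
pose d (h : X) : R := ip (2 *: (x - c)) h.
have dlin : linear d.
  by move=> a y w; rewrite /d ipDr ipZr.
pose dL : {linear X -> R} := HB.pack d (GRing.isLinear.Build _ _ _ _ d dlin).
have dc : continuous dL.
  by rewrite (_ : dL = (ip^~ (2 *: (x - c))) :> (X -> R));
    [exact: continuous_ipl|apply/funext => y; rewrite /= /d ipC].
have E : (fun x : X => `|x - c| ^+ 2) \o shift x =
   cst (`|x - c| ^+ 2) + dL +o_ 0 id.
  apply/eqaddoP => _/posnumP[e].
  near=> h.
  have hle : `|h| <= e%:num by near: h; exact: nbhs0_le.
  rewrite /= !fctE/= /d -!ipxx.
  have -> : ip (h + x - c) (h + x - c) - (ip (x - c) (x - c) + ip (2 *: (x - c)) h)
      = `|h| ^+ 2.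
    rewrite -addrA !(ipDl, ipDr, ipZl, ipZr) -!(ipxx h).
    rewrite (ipC x h) (ipC (- c) h) (ipC (-c) x); ring.
  by rewrite ger0_norm ?sqr_ge0// expr2 ler_wpM2r.
have [dE dcont] : 'd (fun x : X => `|x - c| ^+ 2) x = dL :> (X -> R) /\
   differentiable (fun x : X => `|x - c| ^+ 2) x.
  split; first exact: (@diff_unique _ _ _ _ dL x dc E).
  apply/diff_locallyP.
  by rewrite (@diff_unique _ _ _ _ dL x dc E).
by split => // h; rewrite dE.
Unshelve. all: by end_near. Qed.

End inner_product.

(** * Smooth cutoff functions *)

Section cutoff.
Context {R : realType}.
Implicit Types t : R.

(** The squared positive part: a [C^1] substitute for truncation, which would leave [C1b]. *)
Definition sqrpos t : R := t * Num.max t 0.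

Lemma sqrpos_ge0 t : 0 <= sqrpos t.
Proof. by rewrite /sqrpos; case: (leP t 0) => t0; rewrite ?mulr0// mulr_ge0// ltW. Qed.

Lemma sqrpos_eq0 t : t <= 0 -> sqrpos t = 0.
Proof. by move=> t0; rewrite /sqrpos max_r ?mulr0. Qed.

Lemma sqrpos_id t : 0 <= t -> sqrpos t = t ^+ 2.
Proof. by move=> t0; rewrite /sqrpos max_l ?expr2. Qed.

Lemma sqrpos_gt0 t : (0 < sqrpos t) = (0 < t).
Proof.
case: (leP t 0) => t0; first by rewrite sqrpos_eq0// ltxx.
by rewrite sqrpos_id ?ltW// exprn_gt0.
Qed.

Lemma le_sqrpos s t : s <= t -> sqrpos s <= sqrpos t.
Proof.
move=> st; case: (leP s 0) => s0; first by rewrite (sqrpos_eq0 s0) sqrpos_ge0.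
have t0 := lt_le_trans s0 st; rewrite !sqrpos_id ?(ltW s0) ?(ltW t0)//.
by rewrite ler_pXn2r ?nnegrE ?(ltW s0) ?(ltW t0).
Qed.

(** A quadratic bound on the remainder treats both branches of [sqrpos] and their junction at [0] in
    one way. *)
Lemma is_derive_quadratic (F : R -> R) (y a : R) :
  (forall h, `|F (h + y) - F y - a * h| <= h ^+ 2) -> is_derive y 1 F a.
Proof.
move=> HF.
have lim : h^-1 *: ((F \o shift y) (h *: 1) - F y) @[h --> 0^'] --> a.
  apply/cvgrPdist_le => e e0; near=> h.
  have h0 : h != 0 by near: h; exact: nbhs_dnbhs_neq.
  have he : `|h| <= e by near: h; apply: dnbhs0_le.
  rewrite distrC /= [h *: 1]mulr1.
  have -> : h^-1 *: (F (h + y) - F y) - a = h^-1 * (F (h + y) - F y - a * h).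
    by rewrite /GRing.scale/=; field.
  rewrite normrM normrV ?unitfE// mulrC ler_pdivrMr ?normr_gt0//.
  apply: le_trans (HF h) _; rewrite -real_normK ?num_real// expr2.
  by rewrite ler_wpM2r.
split; first by apply/cvg_ex; exists a.
exact/cvg_lim.
Unshelve. all: by end_near. Qed.

Lemma sqrpos_quadratic t h :
  `|sqrpos (h + t) - sqrpos t - 2 * Num.max t 0 * h| <= h ^+ 2.
Proof.
rewrite /sqrpos ler_norml.
by case: (leP t 0) => t0; case: (leP (h + t) 0) => ht; apply/andP; split; nra.
Qed.

Lemma is_derive_sqrpos t : is_derive t 1 sqrpos (2 * Num.max t 0).
Proof. exact/is_derive_quadratic/sqrpos_quadratic. Qed.

Lemma is_derive_sqrpos_sub a t :
  is_derive t 1 (fun s => sqrpos (a - s)) (- (2 * Num.max (a - t) 0)).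
Proof.
apply: is_derive_quadratic => h.
have := sqrpos_quadratic (a - t) (- h).
by rewrite sqrrN mulrN mulNr opprD addrCA.
Qed.

(** The usual quotient cutoff: [C^1] and nondecreasing, [0] up to [0] and [1] from [1] on. *)
Definition smoothstep t : R := sqrpos t * (sqrpos t + sqrpos (1 - t))^-1.

(** One of [t] and [1 - t] is at least [1 / 2]. The uniform lower bound keeps the reciprocal in
    [C1b]. *)
Lemma smoothstep_den t : 1 / 4 <= sqrpos t + sqrpos (1 - t).
Proof.
have := sqrpos_ge0 t; have := sqrpos_ge0 (1 - t).
case: (leP t (1 / 2)) => t2.
  rewrite (@sqrpos_id (1 - t)); last lra.
  by nra.
rewrite (@sqrpos_id t); last lra.
by nra.
Qed.

Let den_gt0 t : 0 < sqrpos t + sqrpos (1 - t).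
Proof. by apply: lt_le_trans (smoothstep_den t); lra. Qed.

Lemma smoothstep_ge0 t : 0 <= smoothstep t.
Proof. by rewrite mulr_ge0 ?sqrpos_ge0// invr_ge0 ltW. Qed.

Lemma smoothstep_le1 t : smoothstep t <= 1.
Proof. by rewrite ler_pdivrMr// mul1r lerDl sqrpos_ge0. Qed.

Lemma smoothstep0 t : t <= 0 -> smoothstep t = 0.
Proof. by move=> t0; rewrite /smoothstep sqrpos_eq0// mul0r. Qed.

Lemma smoothstep1 t : 1 <= t -> smoothstep t = 1.
Proof.
move=> t1; have := den_gt0 t; rewrite /smoothstep (@sqrpos_eq0 (1 - t)); last lra.
by rewrite addr0 => ?; rewrite divff// lt0r_neq0.
Qed.

Lemma le_smoothstep s t : s <= t -> smoothstep s <= smoothstep t.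
Proof.
move=> st; rewrite /smoothstep ler_pdivrMr// mulrAC ler_pdivlMr//.
(* After cross-multiplication the common product [sqrpos s * sqrpos t] cancels. *)
rewrite !mulrDr (mulrC (sqrpos t) (sqrpos s)) lerD2l.
apply: ler_pM; rewrite ?sqrpos_ge0// le_sqrpos//; lra.
Qed.

End cutoff.

(** * The algebra of [C1b] functions *)

Section C1b.
Context {R : realType} {X : normedModType R} {ip : X -> X -> R}.
Hypothesis hip : is_inner_product ip.

Definition C1b (f : X -> R) := exists g, C1b_grad ip f g.

Lemma C1b_bounded f : C1b f -> exists M, forall x, `|f x| <= M.
Proof. by move=> [g []]. Qed.

Lemma C1b_continuous f : C1b f -> continuous f.
Proof. by move=> [g [_ d _ _]] x; apply: differentiable_continuous; case: (d x). Qed.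

(** Boundedness is asked of the composite and of its gradient, not of [f] and [g], so that [f] may
    be the squared distance. *)
Lemma C1b_comp (F F' : R -> R) (f : X -> R) (g : X -> X) :
  @grad _ _ ip f g -> continuous g ->
  (forall x, is_derive (f x) 1 F (F' (f x))) ->
  (forall x, {for f x, continuous F'}) ->
  (exists M, forall x, `|F (f x)| <= M) ->
  (exists M, forall x, `|F' (f x)| * `|g x| <= M) -> C1b (F \o f).
Proof.
move=> fg cg dF cF' bF [M bg]; exists (fun x => F' (f x) *: g x); split => //.
- exact: grad_comp.
- move=> x; apply: cvgZ; last exact: cg.
  apply: continuous_comp; last exact: cF'.
  by apply: differentiable_continuous; case: (fg x).
- by exists M => x; rewrite normrZ.
Qed.

Lemma C1b_cst a : C1b (cst a).
Proof.
exists (cst 0); split.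
- by exists `|a|.
- exact: grad_cst.
- exact: cst_continuous.
- by exists 0 => x; rewrite normr0.
Qed.

Lemma C1bD f g : C1b f -> C1b g -> C1b (f \+ g).
Proof.
move=> [gf [[M1 b1] d1 c1 [N1 n1]]] [gg [[M2 b2] d2 c2 [N2 n2]]].
exists (gf \+ gg); split.
- by exists (M1 + M2) => x; apply: le_trans (ler_normD _ _) _; rewrite lerD.
- exact: gradD.
- by move=> x; apply: cvgD; [exact: c1|exact: c2].
- by exists (N1 + N2) => x; apply: le_trans (ler_normD _ _) _; rewrite lerD.
Qed.

Lemma C1bM f g : C1b f -> C1b g -> C1b (f \* g).
Proof.
move=> Cf Cg; have cf := C1b_continuous Cf; have cg := C1b_continuous Cg.
move: Cf Cg => [gf [[M1 b1] d1 c1 [N1 n1]]] [gg [[M2 b2] d2 c2 [N2 n2]]].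
exists (fun x => f x *: gg x + g x *: gf x); split.
- by exists (M1 * M2) => x; rewrite normrM ler_pM.
- exact: gradM.
- by move=> x; apply: cvgD; apply: cvgZ; [exact: cf|exact: c2|exact: cg|exact: c1].
- exists (M1 * N2 + M2 * N1) => x; apply: le_trans (ler_normD _ _) _.
  by rewrite !normrZ lerD// ler_pM.
Qed.

Lemma C1bZ a f : C1b f -> C1b (fun x => a * f x).
Proof. exact: C1bM (C1b_cst a). Qed.

Lemma C1bN f : C1b f -> C1b (fun x => - f x).
Proof.
move=> /(C1bZ (-1)); rewrite (_ : (fun x => -1 * f x) = (fun x => - f x))//.
by apply/funext => x; rewrite mulN1r.
Qed.

Lemma C1bB f g : C1b f -> C1b g -> C1b (f \- g).
Proof. by move=> Cf /C1bN; exact: C1bD. Qed.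

Lemma C1b_affine a b f : C1b f -> C1b (fun x => a * f x + b).
Proof. by move=> Cf; apply: (C1bD (C1bZ a Cf) (C1b_cst b)). Qed.

Lemma C1b_sum (I : Type) (r : seq I) (F : I -> X -> R) :
  (forall i, C1b (F i)) -> C1b (fun x => \sum_(i <- r) F i x).
Proof.
move=> CF; elim: r => [|i r IH].
  by under eq_fun do rewrite big_nil; exact: C1b_cst.
by under eq_fun do rewrite big_cons; exact: (C1bD (CF i) IH).
Qed.

Lemma C1b_prod (I : Type) (r : seq I) (F : I -> X -> R) :
  (forall i, C1b (F i)) -> C1b (fun x => \prod_(i <- r) F i x).
Proof.
move=> CF; elim: r => [|i r IH].
  by under eq_fun do rewrite big_nil; exact: C1b_cst.
by under eq_fun do rewrite big_cons; exact: (C1bM (CF i) IH).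
Qed.

Lemma C1b_shift f c : C1b f -> C1b (fun x => f (x + c)).
Proof.
move=> [g [[M b] d cg [N n]]]; exists (fun x => g (x + c)); split.
- by exists M.
- exact: (grad_shift c d).
- move=> x; apply: continuous_comp; last exact: cg.
  by apply: cvgD; [exact: cvg_id|exact: cvg_cst].
- by exists N.
Qed.

Lemma C1b_sqrpos f : C1b f -> C1b (sqrpos \o f).
Proof.
move=> [g [[M b] d cg [N n]]].
have fM x : Num.max (f x) 0 <= M.
  rewrite ge_max (le_trans (ler_norm _) (b x))/=.
  exact: le_trans (normr_ge0 _) (b x).
have max0 x : 0 <= Num.max (f x) 0 by rewrite le_max lexx orbT.
apply: (@C1b_comp _ (fun t => 2 * Num.max t 0) f g) => //.
- by move=> x; exact: is_derive_sqrpos.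
- move=> x; apply: cvgM; first exact: cvg_cst.
  by apply: continuous_max; [exact: cvg_id|exact: cvg_cst].
- by exists (M * M) => x; rewrite normrM ler_pM// ger0_norm.
- exists (2 * M * N) => x; rewrite normrM (@ger0_norm _ 2)// (ger0_norm (max0 x)).
  by rewrite ler_pM// ?mulr_ge0// ler_wpM2l.
Qed.

Lemma C1bV (f : X -> R) (e : R) : 0 < e -> (forall x, e <= f x) -> C1b f -> C1b (fun x => (f x)^-1).
Proof.
move=> e0 ef [g [[M b] d cg [N n]]].
have f0 x : 0 < f x by exact: lt_le_trans (ef x).
apply: (@C1b_comp (fun t => t^-1) (fun t => - (t ^- 2)) f g) => //.
- move=> x.
  apply: is_derive_eq; first by apply: is_deriveV; rewrite lt0r_neq0.
  by rewrite /GRing.scale/= mulr1.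
- move=> x; apply: cvgN; apply: cvgV; first by rewrite expf_neq0// lt0r_neq0.
  exact: exprn_continuous.
- by exists e^-1 => x; rewrite gtr0_norm ?invr_gt0// lef_pV2 ?posrE.
- exists (e ^- 2 * N) => x; rewrite ler_pM// normrN gtr0_norm ?invr_gt0 ?exprn_gt0//.
  by rewrite lef_pV2 ?posrE ?exprn_gt0// ler_pXn2r ?nnegrE ?(ltW e0) ?(ltW (f0 x)).
Qed.

Lemma C1b_smoothstep f : C1b f -> C1b (smoothstep \o f).
Proof.
move=> Cf; apply: C1bM; first exact: C1b_sqrpos.
apply: (@C1bV _ (1 / 4)) => [//|x|]; first exact: smoothstep_den.
apply: C1bD; first exact: C1b_sqrpos.
by apply: C1b_sqrpos; exact: C1bB (C1b_cst 1) Cf.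
Qed.

(** For [r > 0] this is positive exactly on the open ball. The distance is squared because the norm
    is not differentiable at the centre. *)
Definition ball_bump (c : X) (r : R) (x : X) := sqrpos (r ^+ 2 - `|x - c| ^+ 2).

Lemma ball_bump_ge0 c r x : 0 <= ball_bump c r x. Proof. exact: sqrpos_ge0. Qed.

Lemma ball_bump_gt0 c r x : 0 < r -> (0 < ball_bump c r x) = (`|x - c| < r).
Proof.
by move=> r0; rewrite sqrpos_gt0 subr_gt0 ltr_pXn2r ?nnegrE// ltW.
Qed.

Lemma C1b_ball_bump c r : C1b (ball_bump c r).
Proof.
have maxr2 x : 0 <= Num.max (r ^+ 2 - `|x - c| ^+ 2) 0 <= r ^+ 2.
  by rewrite le_max lexx orbT/= ge_max sqr_ge0 andbT lerBlDr lerDl sqr_ge0.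
apply: (@C1b_comp (fun t => sqrpos (r ^+ 2 - t)) (fun t => - (2 * Num.max (r ^+ 2 - t) 0))
  (fun x => `|x - c| ^+ 2) (fun x => 2 *: (x - c))).
- exact: grad_sqr_dist.
- move=> x; apply: (@cvgZ _ _ _ _ _ (cst 2)); first exact: cvg_cst.
  by apply: cvgB; [exact: cvg_id|exact: cvg_cst].
- by move=> x; exact: is_derive_sqrpos_sub.
- move=> x; apply: cvgN; apply: cvgM; first exact: cvg_cst.
  apply: (@continuous_comp _ _ _ (fun t => r ^+ 2 - t) (fun t => Num.max t 0)).
    by apply: cvgB; [exact: cvg_cst|exact: cvg_id].
  by apply: continuous_max; [exact: cvg_id|exact: cvg_cst].
- exists (sqrpos (r ^+ 2)) => x; rewrite ger0_norm ?sqrpos_ge0// le_sqrpos//.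
  by rewrite lerBlDr lerDl sqr_ge0.
- exists (2 * r ^+ 2 * (2 * `|r|)) => x.
  have /andP[m0 m1] := maxr2 x.
  rewrite normrN normrM (ger0_norm m0) (@ger0_norm _ 2)// normrZ (@ger0_norm _ 2)//.
  (* Inside the ball the gradient [2 *: (x - c)] is at most [2 * |r|]; outside it the outer
     derivative vanishes. *)
  have [rx|rx] := leP `|x - c| `|r|.
    by rewrite ler_pM// ?mulr_ge0// ler_wpM2l.
  rewrite max_r; last first.
    by rewrite subr_le0 -(real_normK (num_real r)) ler_pXn2r ?nnegrE// (ltW rx).
  rewrite mulr0 mul0r; apply: mulr_ge0; apply: mulr_ge0 => //; exact: sqr_ge0.
Qed.

End C1b.

Lemma exists_natSinv_lt {R : realType} (e : R) : 0 < e -> exists n, n.+1%:R^-1 < e.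
Proof.
move=> e0; near \oo => n; exists n; near: n.
exact: (near_infty_natSinv_lt (PosNum e0)).
Unshelve. all: by end_near. Qed.

(** * Borel sets *)

Section borel.
Context {R : realType} {X : normedModType R}.

Lemma continuous_borel_measurable (f : X -> R) : continuous f ->
  measurable_fun [set: borelX X] f.
Proof.
move=> cf; apply: (measurability _ (RGenOpens.measurableE R)) => _ /= [_ [a [b ->]] <-].
rewrite setTI; apply: sub_sigma_algebra => /=.
by apply: open_comp => [x _|]; [exact: cf|exact: interval_open].
Qed.

(** An open set is a countable union of balls with centres in the dense set and radii [1 / (n + 1)].
    The family [G] will be the Caratheodory sets, and later the approximable sets. *)
Lemma open_ball_bump_sigma_algebra (G : set (set X)) : separable X ->
  sigma_algebra [set: X] G ->
  (forall c r, 0 < r -> G [set x | 0 < ball_bump c r x]) ->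
  forall U, open U -> G U.
Proof.
move=> [D [/countable_injP[num numI] clD]] sG Gb U oU.
have [G0 _ Gbig] := sG.
(* The injection [num] codes the centres: at most one of them has code [k], so the innermost union
   is a single ball or empty. *)
pose F (k : nat) : set X := \bigcup_(n : nat) \bigcup_(d in
  [set d | D d /\ num d = k /\ [set x | 0 < ball_bump d n.+1%:R^-1 x] `<=` U])
  [set x | 0 < ball_bump d n.+1%:R^-1 x].
have -> : U = \bigcup_k F k.
  apply/seteqP; split => x.
    move=> Ux; have /nbhs_ballP[e /= e0 eU] : nbhs x U by exact: open_nbhs_nbhs.
    have [n ne] : exists n : nat, n.+1%:R^-1 < e / 2.
      exact: exists_natSinv_lt (divr_gt0 e0 _).
    have n0 : 0 < n.+1%:R^-1 :> R by rewrite invr_gt0.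
    have : closure D x by rewrite clD.
    move=> /(_ (ball x n.+1%:R^-1)) [|d [Dd]]; first exact: nbhsx_ballx.
    rewrite -ball_normE /= => xd.
    exists (num d) => //; exists n => //; exists d; last by rewrite /= ball_bump_gt0.
    split => //; split => // y /=; rewrite ball_bump_gt0// => yd.
    apply: eU; rewrite -ball_normE /=.
    rewrite (_ : x - y = (x - d) - (y - d)); last by rewrite opprB addrA subrK.
    apply: le_lt_trans (ler_normB _ _) _.
    by rewrite [ltRHS](splitr e) ltrD// (lt_trans _ ne).
  by move=> [k _ [n _ [d [_ [_ dU]] xd]]]; exact: dU.
apply: (Gbig) => k; apply: (Gbig) => n.
have [[d [Dd [dk dU]]]|nex] := pselect (exists d, D d /\ num d = k /\
    [set x | 0 < ball_bump d n.+1%:R^-1 x] `<=` U).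
  rewrite (_ : \bigcup_(d in _) _ = [set x | 0 < ball_bump d n.+1%:R^-1 x]).
    by apply: Gb; rewrite invr_gt0.
  apply/seteqP; split => x; last by exists d.
  move=> [d' [Dd' [dk' _]]] xd'.
  by rewrite (numI d d') ?inE// dk dk'.
rewrite (_ : \bigcup_(d in _) _ = set0)//.
by apply/seteqP; split => x // [d dP] _; apply: nex; exists d.
Qed.

End borel.

(** * Unit layers of a real number, sharp and smooth *)

Lemma le_sum_layers {R : realType} N (t : R) : 0 <= t -> t <= N%:R ->
  t <= 1 + \sum_(k < N) (k.+1%:R <= t)%R%:R.
Proof.
elim: N t => [|N IH] t t0 tN; first by rewrite big_ord0 addr0 (le_trans tN).
rewrite big_ord_recl/=; have [t1|t1] := leP 1 t; last first.
  by rewrite add0r (le_trans (ltW t1))// lerDl sumr_ge0.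
rewrite -lerBlDl; apply: le_trans (IH (t - 1) _ _) _.
- by rewrite subr_ge0.
- by rewrite lerBlDr -natr1 in tN *.
- by apply: lerD => //; apply: ler_sum => k _; rewrite lerBrDr natr1.
Qed.

(** Induction by lowering [t] by [1]; for [t < 1] only the first layer is nonzero. With
    [le_sum_layers], the sharp layers lose at most [1] and the smooth ones gain at most [1]. *)
Lemma sum_smoothstep_le {R : realType} N (t : R) : 0 <= t ->
  \sum_(k < N) smoothstep (t - k%:R) <= t + 1.
Proof.
elim: N t => [|N IH] t t0; first by rewrite big_ord0 addr_ge0.
rewrite big_ord_recl/= subr0.
rewrite (eq_bigr (fun k : 'I_N => smoothstep (t - 1 - k%:R))); last first.
  by move=> k _; rewrite /= /bump leq0n add1n -natr1 opprD addrA addrAC.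
have [t1|t1] := leP 1 t.
  rewrite addrC; apply: lerD; last exact: smoothstep_le1.
  by apply: le_trans (IH (t - 1) _) _; rewrite ?subr_ge0// subrK.
rewrite big1 ?addr0; first by rewrite (le_trans (smoothstep_le1 t))// lerDr.
move=> k _; apply: smoothstep0; rewrite subr_le0 (le_trans _ (ler0n _ k))//.
by rewrite subr_le0 ltW.
Qed.

(** * Daniell's representation of positive functionals on [C1b] *)

Section daniell.
Context {R : realType} {X : normedModType R} {ip : X -> X -> R}.
Hypothesis hip : is_inner_product ip.
Hypothesis hsep : separable X.

Definition C1b_ge0 (f : X -> R) := C1b (ip := ip) f /\ forall x, 0 <= f x.

(** Everything is stated on the nonnegative cone, the natural domain of the positive part of a
    functional. The last clause is Daniell's continuity. *)
Definition daniell_functional (I : (X -> R) -> R) :=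
  [/\ forall f g, C1b_ge0 f -> C1b_ge0 g -> I (f \+ g) = I f + I g,
      forall a f, 0 <= a -> C1b_ge0 f -> I (fun x => a * f x) = a * I f,
      forall f, C1b_ge0 f -> 0 <= I f &
      forall f : nat -> X -> R, (forall n, C1b_ge0 (f n)) ->
        (forall n x, f n.+1 x <= f n x) ->
        (forall x e, 0 < e -> exists n, f n x <= e) ->
        forall e, 0 < e -> exists n, I (f n) <= e].

Context {I : (X -> R) -> R}.
Hypothesis hI : daniell_functional I.

Lemma C1b_ge0_cst a : 0 <= a -> C1b_ge0 (cst a).
Proof. by move=> a0; split=> //; exact: C1b_cst. Qed.

Lemma C1b_ge0D f g : C1b_ge0 f -> C1b_ge0 g -> C1b_ge0 (f \+ g).
Proof. by move=> [Cf f0] [Cg g0]; split; [exact: C1bD|move=> x; exact: addr_ge0]. Qed.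

Lemma C1b_ge0M f g : C1b_ge0 f -> C1b_ge0 g -> C1b_ge0 (f \* g).
Proof. by move=> [Cf f0] [Cg g0]; split; [exact: C1bM|move=> x; exact: mulr_ge0]. Qed.

Lemma C1b_ge0B f g : C1b_ge0 f -> C1b_ge0 g -> (forall x, f x <= g x) ->
  C1b_ge0 (g \- f).
Proof.
by move=> [Cf f0] [Cg g0] fg; split; [exact: C1bB|move=> x; rewrite subr_ge0].
Qed.

Lemma C1b_ge0_sum (T : Type) (r : seq T) (F : T -> X -> R) :
  (forall i, C1b_ge0 (F i)) -> C1b_ge0 (fun x => \sum_(i <- r) F i x).
Proof.
move=> CF; split; first by apply: C1b_sum => // i; case: (CF i).
by move=> x; apply: sumr_ge0 => i _; case: (CF i).
Qed.

Lemma C1b_ge0_smoothstep f : C1b (ip := ip) f -> C1b_ge0 (smoothstep \o f).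
Proof. by move=> Cf; split; [exact: C1b_smoothstep|move=> x; exact: smoothstep_ge0]. Qed.

Lemma daniellD f g : C1b_ge0 f -> C1b_ge0 g -> I (f \+ g) = I f + I g.
Proof. by case: hI => + _ _ _; exact. Qed.

Lemma daniellZ a f : 0 <= a -> C1b_ge0 f -> I (fun x => a * f x) = a * I f.
Proof. by case: hI => _ + _ _; exact. Qed.

Lemma daniell_ge0 f : C1b_ge0 f -> 0 <= I f.
Proof. by case: hI => _ _ + _; exact. Qed.

Lemma daniell0 : I (cst 0) = 0.
Proof.
have := @daniellZ 0 (cst 0) (lexx 0) (C1b_ge0_cst (lexx 0)).
by rewrite mul0r => H; rewrite -[RHS]H; congr I; apply/funext => x; rewrite mul0r.
Qed.

Lemma daniellB f g : C1b_ge0 f -> C1b_ge0 g -> (forall x, f x <= g x) ->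
  I (g \- f) = I g - I f.
Proof.
move=> Cf Cg fg; apply/eqP; rewrite eq_sym subr_eq -daniellD//; last exact: C1b_ge0B.
by apply/eqP; congr I; apply/funext => x /=; rewrite subrK.
Qed.

Lemma le_daniell f g : C1b_ge0 f -> C1b_ge0 g -> (forall x, f x <= g x) -> I f <= I g.
Proof. by move=> Cf Cg fg; rewrite -subr_ge0 -daniellB//; apply: daniell_ge0; exact: C1b_ge0B. Qed.

Lemma daniell_sum (T : Type) (r : seq T) (F : T -> X -> R) : (forall i, C1b_ge0 (F i)) ->
  I (fun x => \sum_(i <- r) F i x) = \sum_(i <- r) I (F i).
Proof.
move=> CF; elim: r => [|i r IH].
  by rewrite big_nil -[RHS]daniell0; congr I; apply/funext => x; rewrite big_nil.
rewrite big_cons -IH -daniellD//; last exact: C1b_ge0_sum.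
by congr I; apply/funext => x; rewrite big_cons.
Qed.

(** The increasing sequence stands for its supremum, a function above the indicator of [A] with
    integral at most [c]; the value [1] is reached at a finite stage. *)
Definition daniell_cover (A : set X) (c : R) := exists f : nat -> X -> R,
  [/\ forall n, C1b_ge0 (f n),
      forall m n x, (m <= n)%N -> f m x <= f n x,
      forall n, I (f n) <= c &
      forall x, A x -> exists n, 1 <= f n x].

Definition daniell_outer (A : set X) : \bar R :=
  ereal_inf [set c%:E | c in daniell_cover A].

Lemma daniell_cover_ge0 A c : daniell_cover A c -> 0 <= c.
Proof. by move=> [f [Cf _ fc _]]; exact: le_trans (daniell_ge0 (Cf 0%N)) (fc 0%N). Qed.

Lemma daniell_outer_le A c : daniell_cover A c -> (daniell_outer A <= c%:E)%E.
Proof. by move=> Ac; apply: ereal_inf_lbound; exists c. Qed.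

Lemma daniell_cover1 A f : C1b_ge0 f -> (forall x, A x -> 1 <= f x) ->
  daniell_cover A (I f).
Proof. by move=> Cf Af; exists (fun=> f); split => // x Ax; exists 0%N; exact: Af. Qed.

Lemma daniell_outer_ge0 A : (0 <= daniell_outer A)%E.
Proof.
by apply: le_ereal_inf_tmp => _ [c Ac <-]; rewrite lee_fin; exact: daniell_cover_ge0 Ac.
Qed.

Lemma daniell_outer0 : daniell_outer set0 = 0%E.
Proof.
apply/eqP; rewrite eq_le daniell_outer_ge0 andbT -[X in (_ <= X)%E]/(0%:E) -daniell0.
by apply: daniell_outer_le; apply: daniell_cover1 => //; exact: C1b_ge0_cst.
Qed.

Lemma daniell_outer_fin_num A : daniell_outer A \is a fin_num.
Proof.
rewrite ge0_fin_numE ?daniell_outer_ge0//; apply: le_lt_trans (ltry (I (cst 1))).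
by apply: daniell_outer_le; apply: daniell_cover1 => //; exact: C1b_ge0_cst.
Qed.

(** Covers of the [F n], with errors [e / 2 ^ (n + 1)], are combined diagonally: stage [n] adds up
    stage [n] of the first [n] covers. *)
Lemma daniell_outer_sigma_subadditive A F : subset_sigma_subadditive daniell_outer A F.
Proof.
move=> AF; apply/lee_addgt0Pr => e e0.
apply: le_trans (epsilon_trick xpredT (fun n => daniell_outer_ge0 (F n)) (ltW e0)).
have /choice[c cP] n : exists c, daniell_cover (F n) c /\
    (c%:E <= daniell_outer (F n) + (e / (2 ^ n.+1)%:R)%:E)%E.
  have d0 : 0 < e / (2 ^ n.+1)%:R by rewrite divr_gt0// ltr0n expn_gt0.
  have [_ [c Fc <-] cF] := lb_ereal_inf_adherent d0 (daniell_outer_fin_num (F n)).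
  by exists c; split => //; exact: ltW.
set S := (X in (_ <= X)%E).
have cS N : ((\sum_(i < N) c i)%:E <= S)%E.
  rewrite -sumEFin; apply: (@le_trans _ _
      (\sum_(i < N) (daniell_outer (F i) + (e / (2 ^ i.+1)%:R)%:E))%E).
    by apply: lee_sum => i _; case: (cP i).
  rewrite -(big_mkord xpredT (fun i => daniell_outer (F i) + (e / (2 ^ i.+1)%:R)%:E)%E).
  apply: nneseries_lim_ge => i _ _; apply: adde_ge0; first exact: daniell_outer_ge0.
  by rewrite lee_fin divr_ge0// ltW.
have [->|Sy] := eqVneq S +oo%E; first exact: leey.
have Sfin : S \is a fin_num.
  rewrite ge0_fin_numE ?ltey//; apply: le_trans (cS 0%N).
  by rewrite big_ord0.
rewrite -(fineK Sfin); apply: daniell_outer_le.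
have /choice[f fP] n := (cP n).1.
exists (fun n x => \sum_(i < n) f i n x); split.
- by move=> n; apply: C1b_ge0_sum => i; case: (fP i).
- move=> m n x mn.
  rewrite -!(big_mkord xpredT (fun i => f i _ x)) [leRHS](big_cat_nat (n := m))//=.
  apply: ler_wpDr; last by apply: ler_sum => i _; case: (fP i) => _ + _ _; exact.
  by apply: sumr_ge0 => i _; case: (fP i) => /(_ n)[].
- move=> n; rewrite daniell_sum; last by move=> i; case: (fP i).
  apply: (@le_trans _ _ (\sum_(i < n) c i)).
    by apply: ler_sum => i _; case: (fP i).
  by rewrite -lee_fin fineK.
- move=> x /AF[i _ Fix]; case: (fP i) => Cf mf _ /(_ x Fix)[n f1].
  (* Late enough both for the [i]-th cover to exceed [1] at [x] and for the term [i] to occur in the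
     sum. *)
  exists (maxn n i.+1).
  rewrite (bigD1 (Ordinal (leq_maxr n i.+1 : (i < _)%N)))//=.
  apply: ler_wpDr; last by apply: le_trans f1 _; apply: mf; exact: leq_maxl.
  by apply: sumr_ge0 => j _; case: (fP j) => /(_ (maxn n i.+1))[].
Qed.


HB.instance Definition _ := isSubsetOuterMeasure.Build R X daniell_outer
  daniell_outer0 daniell_outer_ge0 daniell_outer_sigma_subadditive.

(* [chi k] increases to the indicator of the ball and, of two consecutive terms,
   at each point either the first vanishes or the second is [1]; so a cover of [B]
   splits along [chi k.+1] up to the small tail [chi (k + n) - chi k]. *)
Lemma daniell_outer_caratheodory c r : 0 < r ->
  caratheodory_measurable daniell_outer [set x | 0 < ball_bump c r x].
Proof.
move=> r0; apply: (@le_caratheodory_measurable R X daniell_outer) => B.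
set A := [set x | _]; pose q := ball_bump c r.
pose chi k x := smoothstep (2 ^+ k * q x + -1).
have Cchi k : C1b_ge0 (chi k).
  by apply: C1b_ge0_smoothstep; apply: C1b_affine => //; exact: C1b_ball_bump.
have chi1 k x : chi k x <= 1 by exact: smoothstep_le1.
have chi_mono m n x : (m <= n)%N -> chi m x <= chi n x.
  move=> mn; apply: le_smoothstep; rewrite lerD2r ler_wpM2r ?ball_bump_ge0//.
  by rewrite ler_weXn2l// ler1n.
have chi0 k x : ~ A x -> chi k x = 0.
  move=> /negP; rewrite -leNgt => q0; apply: smoothstep0.
  have -> : q x = 0 by apply/eqP; rewrite eq_le q0 ball_bump_ge0.
  by rewrite mulr0 add0r lerN10.
have chi_eventually x : A x -> exists n, chi n x = 1.
  move=> qx; have [n qn] := exists_natSinv_lt (divr_gt0 qx (@ltr0Sn R 1)).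
  exists n; apply: smoothstep1.
  rewrite -lerBlDr opprK -ler_pdivrMr//.
  have n2 : n.+1%:R <= 2 ^+ n :> R by rewrite -natrX ler_nat ltn_expl.
  apply: le_trans n2; rewrite ler_pdivrMr//.
  move: qn; rewrite -[X in X < _]mul1r ltr_pdivrMr// => /ltW.
  by rewrite mulrAC ler_pdivlMr// mul1r mulrC.
have chi01 k x : chi k x = 0 \/ chi k.+1 x = 1.
  have [qk|qk] := leP (2 ^+ k * q x) 1.
    by left; apply: smoothstep0; rewrite subr_le0.
  right; apply: smoothstep1; rewrite exprS -mulrA; lra.
apply: le_ereal_inf_tmp => _ [M [f [Cf mf fM Bf]] <-].
apply/lee_addgt0Pr => d d0.
have [k chik] : exists k, forall n, I (chi n) <= I (chi k) + d.
  have hs : has_sup [set I (chi n) | n in [set: nat]].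
    split; first by exists (I (chi 0%N)), 0%N.
    exists (I (cst 1)) => _ [n _ <-]; apply: le_daniell => //.
    exact: C1b_ge0_cst.
  have [_ [k _ <-] kd] := sup_adherent d0 hs.
  exists k => n; rewrite -lerBlDr; apply: le_trans (ltW kd).
  by rewrite lerD2r; apply: ub_le_sup; [case: hs|exists n].
have Cfchi n : C1b_ge0 (f n \* chi k.+1) by exact: C1b_ge0M.
have fchi_le n x : (f n \* chi k.+1) x <= f n x.
  by rewrite /= ler_piMr//; case: (Cf n).
have Cfchi' n : C1b_ge0 (f n \- (f n \* chi k.+1)) by exact: C1b_ge0B.
have hs : has_sup [set I (f n \* chi k.+1) | n in [set: nat]].
  split; first by exists (I (f 0%N \* chi k.+1)), 0%N.
  by exists M => _ [n _ <-]; apply: le_trans (fM n); exact: le_daniell.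
set a := sup [set I (f n \* chi k.+1) | n in [set: nat]].
have fa n : I (f n \* chi k.+1) <= a by apply: ub_le_sup; [case: hs|exists n].
(* The share of [M] carried by [f n * chi k.+1] is [a]; the trace of [B] on the ball gets [a + d],
   the rest of [B] gets [M - a]. *)
rewrite [leRHS](_ : _ = (a + d)%:E + (M - a)%:E)%E; last by rewrite -!EFinD; congr EFin; ring.
apply: leeD; apply: daniell_outer_le.
  exists (fun n => (f n \* chi k.+1) \+ (chi (k + n)%N \- chi k)); split.
  - move=> n; apply: C1b_ge0D => //; apply: C1b_ge0B => // x.
    by apply: chi_mono; exact: leq_addr.
  - move=> m n x mn; apply: lerD; last by rewrite lerD2r chi_mono// leq_add2l.
    by rewrite ler_wpM2r// ?smoothstep_ge0// mf.
  - move=> n; rewrite daniellD//; last first.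
      by apply: C1b_ge0B => // x; apply: chi_mono; exact: leq_addr.
    apply: lerD => //; rewrite daniellB//; first by rewrite lerBlDl.
    by move=> x; apply: chi_mono; exact: leq_addr.
  - move=> x [Bx Ax]; have [chik0|chik1] := chi01 k x.
      have [n chin] := chi_eventually x Ax; exists n.
      rewrite /= chik0 subr0 (_ : chi (k + n)%N x = 1).
        by rewrite lerDr mulr_ge0 ?smoothstep_ge0//; case: (Cf n).
      by apply/eqP; rewrite eq_le chi1/= -chin chi_mono// leq_addl.
    have [n fn] := Bf x Bx; exists n.
    rewrite /= chik1 mulr1 (le_trans fn)// lerDl subr_ge0.
    by apply: chi_mono; exact: leq_addr.
exists (fun n => f n \- (f n \* chi k.+1)); split => //.
- move=> m n x mn /=; rewrite -[X in X - _]mulr1 -[X in _ <= X - _]mulr1 -!mulrBr.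
  by rewrite ler_wpM2r ?subr_ge0// mf.
- move=> n; rewrite daniellB// lerBrDl -lerBrDr; apply: ge_sup.
    by exists (I (f 0%N \* chi k.+1)), 0%N.
  move=> _ [m _ <-]; rewrite -lerBlDr opprB.
  (* Both [f n * chi k.+1] and its complement in [f n] increase with [n], so two different stages
     are compared at the later one. *)
  have [mn|nm] := leqP m n.
    rewrite (le_trans _ (fM n))//.
    have : I (f m \* chi k.+1) <= I (f n \* chi k.+1).
      by apply: le_daniell => // x; rewrite ler_wpM2r ?smoothstep_ge0// mf.
    by lra.
  have : I (f n \- (f n \* chi k.+1)) <= I (f m \- (f m \* chi k.+1)).
    apply: le_daniell => // x /=.
    rewrite -[X in X - _]mulr1 -[X in _ <= X - _]mulr1 -!mulrBr.
    by rewrite ler_wpM2r ?subr_ge0// mf// ltnW.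
  by rewrite !daniellB//; have := fM m; lra.
- move=> x [Bx Ax]; have [n fn] := Bf x Bx; exists n.
  by rewrite /= chi0// mulr0 subr0.
Qed.


Lemma borel_caratheodory (A : set (borelX X)) : measurable A ->
  caratheodory_measurable daniell_outer A.
Proof.
have sC : sigma_algebra [set: X] (caratheodory_measurable daniell_outer).
  split; first exact: (caratheodory_measurable_set0 daniell_outer).
    by move=> B mB; rewrite setTD; exact: (caratheodory_measurable_setC mB).
  by move=> F mF; exact: (caratheodory_measurable_bigcup mF).
apply: smallest_sub => // U oU.
by apply: open_ball_bump_sigma_algebra => // c r; exact: daniell_outer_caratheodory.
Qed.

(** The outer measure again, with its domain read as [borelX X] so that the measure structure can be
    attached. *)
Definition daniell_measure : set (borelX X) -> \bar R := daniell_outer.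

Let daniell_measure_sigma_additive : semi_sigma_additive daniell_measure.
Proof.
move=> F mF tF mUF.
apply: (@caratheodory_measure_sigma_additive R X daniell_outer) => //.
- by move=> n; exact: borel_caratheodory.
- exact: borel_caratheodory.
Qed.

HB.instance Definition _ := isMeasure.Build _ (borelX X) R daniell_measure
  daniell_outer0 daniell_outer_ge0 daniell_measure_sigma_additive.

HB.instance Definition _ := @Measure_isFinite.Build _ (borelX X) R daniell_measure
  (fun A _ => daniell_outer_fin_num A).

(* If [f n] increases and [sup_n f n >= 1], then [sqrpos (1 - f n)] decreases to [0],
   and [1 - f n <= sqrpos (1 - f n) / (4 d) + d]. *)
Lemma daniell_measure_setT : daniell_measure [set: X] = (I (cst 1))%:E.
Proof.
have C1 : C1b_ge0 (cst 1) := C1b_ge0_cst ler01.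
apply/eqP; rewrite eq_le; apply/andP; split.
  by apply: daniell_outer_le; exact: daniell_cover1.
apply: le_ereal_inf_tmp => _ [M [f [Cf mf fM f1]] <-]; rewrite lee_fin.
pose g n x := sqrpos (1 - f n x).
have Cg n : C1b_ge0 (g n).
  split; last by move=> x; exact: sqrpos_ge0.
  apply: (@C1b_sqrpos _ _ _ hip (fun x => 1 - f n x)).
  by apply: (C1bB hip (C1b_cst hip 1)); case: (Cf n).
have I1 := daniell_ge0 C1.
apply/ler_addgt0Pr => e e0.
(* This makes [d * I (cst 1)] at most [e / 2]; the bound [2 * d * e] chosen below for [I (g n)]
   gives the other [e / 2] after division by [4 * d]. *)
pose d : R := e / (2 * (I (cst 1) + 1)).
have d0 : 0 < d by rewrite divr_gt0// mulr_gt0// ltr_wpDl.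
have [_ _ _ /(_ g Cg)] := hI.
have g_dec n x : g n.+1 x <= g n x by apply: le_sqrpos; rewrite lerD2l lerN2 mf.
have g_lim x (r : R) : 0 < r -> exists n, g n x <= r.
  move=> r0; have [n fn] := f1 x Logic.I; exists n.
  by rewrite /g sqrpos_eq0 ?subr_le0// (ltW r0).
have d4 : 0 < 4 * d by apply: mulr_gt0.
have ed0 : 0 < 2 * d * e by apply: mulr_gt0 => //; apply: mulr_gt0.
move=> /(_ g_dec g_lim _ ed0)[n gn].
have Cdg : C1b_ge0 (fun x => (4 * d)^-1 * g n x).
  apply: (@C1b_ge0M (cst ((4 * d)^-1))) => //; apply: C1b_ge0_cst.
  by rewrite invr_ge0 (ltW d4).
have Cd : C1b_ge0 (fun=> d * 1) by apply: C1b_ge0_cst; rewrite mulr1 ltW.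
have : I (cst 1) <= I (f n \+ ((fun x => (4 * d)^-1 * g n x) \+ (fun=> d * 1))).
  apply: le_daniell => //; first by do 2 apply: C1b_ge0D => //.
  move=> x /=; rewrite mulr1 /g.
  have [fx|fx] := leP (f n x) 1.
    rewrite sqrpos_id ?subr_ge0//.
    rewrite -subr_ge0 (_ : _ - 1 = (4 * d)^-1 * (1 - f n x - 2 * d) ^+ 2).
      by rewrite mulr_ge0 ?sqr_ge0// invr_ge0 (ltW d4).
    by field; exact: lt0r_neq0.
  rewrite sqrpos_eq0; last by rewrite subr_le0 ltW.
  by rewrite mulr0 add0r -[leLHS]addr0 lerD// ltW.
rewrite !daniellD//; last exact: C1b_ge0D.
rewrite daniellZ//; last by rewrite invr_ge0 (ltW d4).
rewrite (@daniellZ d (cst 1)) ?(ltW d0)// => /le_trans; apply.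
apply: lerD => //.
rewrite [leRHS](splitr e); apply: lerD.
  rewrite ler_pdivrMl//; apply: le_trans gn _.
  by rewrite le_eqVlt; apply/orP; left; apply/eqP; field.
have I10 : 0 < 2 * (I (cst 1) + 1) by apply: mulr_gt0 => //; rewrite ltr_wpDl.
by rewrite /d mulrAC ler_pdivrMr//; nra.
Qed.

(** * Integration against the Daniell measure *)

Let lambda : {finite_measure set (borelX X) -> \bar R} := daniell_measure.

Let C1b_measurable f : C1b_ge0 f -> measurable_fun [set: borelX X] f.
Proof. by move=> [Cf _]; apply: continuous_borel_measurable; exact: C1b_continuous Cf. Qed.

(** Cut [n * f] into layers: it is at most [1] plus the indicators of the sets [A k], each [s k]
    covers [A k], and the [s k] add up to at most [n * f + 1]. Dividing by [n] leaves an error of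
    [2 * I (cst 1) / n]. *)
Lemma daniell_integral_le f : C1b_ge0 f -> (forall x, f x <= 1) ->
  (\int[lambda]_x (f x)%:E <= (I f)%:E)%E.
Proof.
move=> Cf f1; have mf := C1b_measurable Cf; have f0 := Cf.2.
have C1 : C1b_ge0 (cst 1) := C1b_ge0_cst ler01.
have I1 := daniell_ge0 C1.
suff H (N : nat) : (\int[lambda]_x (f x)%:E <=
    (I f + 2 * I (cst 1) / N.+1%:R)%:E)%E.
  apply/lee_addgt0Pr => e e0.
  have [N Ne] : exists N, N.+1%:R^-1 < e / (2 * I (cst 1) + 1).
    by apply: exists_natSinv_lt; rewrite divr_gt0// ltr_wpDl// mulr_ge0.
  apply: le_trans (H N) _; rewrite -EFinD lee_fin lerD2l.
  apply: (@le_trans _ _ (2 * I (cst 1) * (e / (2 * I (cst 1) + 1)))).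
    by rewrite ler_wpM2l ?mulr_ge0// ltW.
  rewrite mulrA ler_pdivrMr; last by rewrite ltr_wpDl// mulr_ge0.
  by rewrite mulrDr mulr1 mulrC lerDl ltW.
set n := N.+1; have n0 : 0 < n%:R :> R by rewrite ltr0n.
pose A k : set (borelX X) := [set x | k.+1%:R <= n%:R * f x].
have mA k : measurable (A k).
  have mnf : measurable_fun [set: borelX X] (fun x => n%:R * f x).
    exact: measurable_funM.
  have := mnf measurableT `[k.+1%:R, +oo[%classic (measurable_itv _).
  by rewrite setTI (_ : _ @^-1` _ = A k)//; apply/seteqP; split => x /=;
    rewrite in_itv/= andbT.
pose s k x := smoothstep (n%:R * f x + - k%:R).
have Cs k : C1b_ge0 (s k) by apply: C1b_ge0_smoothstep; apply: C1b_affine => //; case: Cf.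
have lA k : (lambda (A k) <= (I (s k))%:E)%E.
  apply: daniell_outer_le; apply: daniell_cover1 => // x Akx.
  by rewrite /s smoothstep1// lerBrDr nat1r.
have mind k : measurable_fun [set: borelX X] (fun x => (\1_(A k) x)%:E : \bar R).
  by apply/measurable_EFinP; exact: measurable_indic.
have ind0 x : (0 <= \sum_(k < n) (\1_(A k) x)%:E :> \bar R)%E.
  by apply: sume_ge0 => k _; rewrite lee_fin.
apply: (@le_trans _ _ (\int[lambda]_x ((n%:R^-1)%:E *
    (1 + \sum_(k < n) (\1_(A k) x)%:E)))%E).
  apply: ge0_le_integral => //.
  - by move=> x _; rewrite lee_fin.
  - exact/measurable_EFinP.
  - apply: emeasurable_funM => //; apply: emeasurable_funD => //.
    by apply: emeasurable_sum => k; exact: mind.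
  - move=> x _; rewrite sumEFin -EFinD -EFinM lee_fin ler_pdivlMl//.
    apply: le_trans (le_sum_layers (N := n) _ _) _.
    + by rewrite mulr_ge0// ltW.
    + by rewrite ler_piMr// ltW.
    + rewrite lerD2l; apply: ler_sum => k _; rewrite indicE.
      by have [kx|//] := boolP (k.+1%:R <= n%:R * f x); rewrite mem_set.
rewrite ge0_integralZl_EFin//; last 2 first.
- by move=> x _; exact: adde_ge0.
- by apply: emeasurable_funD => //; apply: emeasurable_sum => k; exact: mind.
rewrite ge0_integralD//; last by apply: emeasurable_sum => k; exact: mind.
rewrite integral_cst// mul1e ge0_integral_sum//.
rewrite (eq_bigr (fun k : 'I_n => lambda (A k))); last first.
  by move=> k _; rewrite integral_indic// setIT.
apply: (@le_trans _ _ ((n%:R^-1)%:E * ((I (cst 1))%:E + \sum_(k < n) (I (s k))%:E))%E).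
  apply: lee_wpmul2l; first by rewrite lee_fin invr_ge0 ltW.
  by apply: leeD; [rewrite -daniell_measure_setT|apply: lee_sum => k _].
rewrite sumEFin -EFinD -EFinM lee_fin -(@daniell_sum _ _ (fun k : 'I_n => s k))//.
rewrite ler_pdivrMl// mulrDr mulrCA divff ?lt0r_neq0// mulr1.
have : I (fun x => \sum_(k < n) s k x) <= I ((fun x => n%:R * f x) \+ cst 1).
  apply: le_daniell => //; first exact: C1b_ge0_sum.
    by apply: C1b_ge0D => //; apply: C1b_ge0M => //; apply: C1b_ge0_cst; exact: ltW.
  by move=> x; apply: sum_smoothstep_le; rewrite mulr_ge0// ltW.
rewrite daniellD//; last by apply: C1b_ge0M => //; apply: C1b_ge0_cst; exact: ltW.
rewrite daniellZ ?(ltW n0)//; lra.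
Qed.

(** For [f <= 1] the inequality holds for [f] and for [1 - f]; both sides add up to [I (cst 1)],
    which forces equality. A bounded [f] is first rescaled below [1]. *)
Lemma daniell_integral f : C1b_ge0 f -> (\int[lambda]_x (f x)%:E = (I f)%:E)%E.
Proof.
have C1 : C1b_ge0 (cst 1) := C1b_ge0_cst ler01.
have le1 g : C1b_ge0 g -> (forall x, g x <= 1) -> (\int[lambda]_x (g x)%:E = (I g)%:E)%E.
  move=> Cg g1; have mg := C1b_measurable Cg; have g0 := Cg.2.
  have Cg' : C1b_ge0 (cst 1 \- g) by exact: C1b_ge0B.
  have mg' := C1b_measurable Cg'.
  have g'1 x : (cst 1 \- g) x <= 1 by rewrite /= gerBl.
  have := daniell_integral_le Cg' g'1; have := daniell_integral_le Cg g1.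
  have : (\int[lambda]_x ((g x)%:E + ((cst 1 \- g) x)%:E) = (I (cst 1))%:E)%E.
    rewrite -daniell_measure_setT -[RHS](mul1e) -integral_cst//.
    by apply: eq_integral => x _; rewrite -EFinD /= addrC subrK.
  rewrite ge0_integralD//; last 4 first.
  - by move=> x _; rewrite lee_fin.
  - exact/measurable_EFinP.
  - by move=> x _; rewrite lee_fin; case: Cg'.
  - exact/measurable_EFinP.
  rewrite daniellB//.
  have : (0 <= \int[lambda]_x (g x)%:E)%E.
    by apply: integral_ge0 => x _; rewrite lee_fin.
  have : (0 <= \int[lambda]_x ((cst 1 \- g) x)%:E)%E.
    by apply: integral_ge0 => x _; rewrite lee_fin; case: Cg'.
  case: (\int[lambda]_x (g x)%:E)%E => [a||]//; case: (\int[lambda]_x _)%E => [b||]//.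
  rewrite -EFinD !lee_fin => _ _ [ab] ale ble; congr EFin.
  by apply/eqP; rewrite eq_le ale/=; lra.
move=> Cf; have mf := C1b_measurable Cf; have f0 := Cf.2.
have [M fM] := C1b_bounded Cf.1.
pose c := (`|M| + 1)^-1; have c0 : 0 < c by rewrite invr_gt0 ltr_wpDl.
have Ccf : C1b_ge0 (fun x => c * f x).
  by apply: (@C1b_ge0M (cst c)) => //; apply: C1b_ge0_cst; exact: ltW.
have cf1 x : c * f x <= 1.
  rewrite ler_pdivrMl ?ltr_wpDl// mulr1.
  apply: (le_trans (ler_norm _)); apply: (le_trans (fM x)).
  by rewrite (le_trans (ler_norm _))// lerDl.
have := le1 _ Ccf cf1; rewrite daniellZ ?(ltW c0)//.
under eq_integral do rewrite EFinM.
rewrite ge0_integralZl_EFin//; last 3 first.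
- by move=> x _; rewrite lee_fin.
- exact/measurable_EFinP.
- exact: ltW.
have : (0 <= \int[lambda]_x (f x)%:E)%E.
  by apply: integral_ge0 => x _; rewrite lee_fin.
case: (\int[lambda]_x _)%E => [a||]//.
  by move=> _; rewrite -EFinM => -[/(mulfI (lt0r_neq0 c0))->].
by rewrite gt0_muley ?lte_fin.
Qed.

End daniell.

Lemma daniell_representation {R : realType} {X : normedModType R}
  (ip : X -> X -> R) (I : (X -> R) -> R) :
  is_inner_product ip -> separable X -> daniell_functional (ip := ip) I ->
  exists lambda : {finite_measure set (borelX X) -> \bar R},
    forall f, C1b_ge0 (ip := ip) f -> (\int[lambda]_x (f x)%:E = (I f)%:E)%E.
Proof.
by move=> hip hsep hI; eexists => f Cf; exact: (daniell_integral hip hsep hI Cf).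
Qed.

(** * Signed functionals on [C1b] *)

Section signed_functional.
Context {R : realType} {X : normedModType R} {ip : X -> X -> R}.
Hypothesis hip : is_inner_product ip.
Hypothesis hsep : separable X.
Notation C1b := (C1b (ip := ip)).
Notation C1b_ge0 := (C1b_ge0 (ip := ip)).

Definition linear_functional (L : (X -> R) -> R) :=
  (forall f g, C1b f -> C1b g -> L (f \+ g) = L f + L g) /\
  (forall a f, C1b f -> L (fun x => a * f x) = a * L f).

Definition bounded_functional (L : (X -> R) -> R) (C : R) :=
  forall f, C1b f -> (forall x, `|f x| <= 1) -> `|L f| <= C.

Definition vanishing_sequence (f : nat -> X -> R) :=
  [/\ forall n, C1b_ge0 (f n), forall n x, f n.+1 x <= f n x &
      forall x e, 0 < e -> exists n, f n x <= e].

(** Uniformity in [theta] is the point: it passes to the supremum defining [pos_functional] and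
    yields Daniell's continuity there. *)
Definition tight_functional (L : (X -> R) -> R) :=
  forall f, vanishing_sequence f -> forall e, 0 < e -> exists n, forall theta,
    C1b theta -> (forall x, `|theta x| <= f n x) -> `|L theta| <= e.

Context {L : (X -> R) -> R} {C : R}.
Hypothesis linL : linear_functional L.
Hypothesis bndL : bounded_functional L C.

Lemma functional0 : L (cst 0) = 0.
Proof.
have := linL.2 0 _ (C1b_cst hip 0); rewrite mul0r => H; rewrite -[RHS]H.
by congr L; apply/funext => x; rewrite mul0r.
Qed.

Lemma functional_le f b : C1b f -> 0 < b -> (forall x, `|f x| <= b) -> `|L f| <= C * b.
Proof.
move=> Cf b0 fb; have := bndL (C1bZ hip b^-1 Cf).
rewrite linL.2// normrM gtr0_norm ?invr_gt0// ler_pdivrMl// mulrC; apply => x.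
by rewrite normrM gtr0_norm ?invr_gt0// ler_pdivrMl// mulr1.
Qed.

(** The positive part of [L] in the sense of Riesz; the negative part is then
    [pos_functional f - L f]. *)
Definition pos_functional (f : X -> R) : R :=
  sup [set L theta | theta in [set theta | C1b_ge0 theta /\ forall x, theta x <= f x]].

Lemma pos_functional_has_sup f : C1b_ge0 f ->
  has_sup [set L theta | theta in [set theta | C1b_ge0 theta /\ forall x, theta x <= f x]].
Proof.
move=> [Cf f0]; split; first by exists (L f), f.
have [M fM] := C1b_bounded Cf.
exists (C * (`|M| + 1)) => _ [theta [[Ct t0] tf] <-].
apply: le_trans (ler_norm _) _; apply: functional_le => // x.
rewrite ger0_norm// (le_trans (tf x))// (le_trans (ler_norm _))// (le_trans (fM x))//.
by rewrite (le_trans (ler_norm _))// lerDl.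
Qed.

Lemma pos_functional_ub f theta : C1b_ge0 f -> C1b_ge0 theta ->
  (forall x, theta x <= f x) -> L theta <= pos_functional f.
Proof.
move=> Cf Ct tf; apply: ub_le_sup; last by exists theta.
by case: (pos_functional_has_sup Cf).
Qed.

Lemma pos_functional_le f a : C1b_ge0 f ->
  (forall theta, C1b_ge0 theta -> (forall x, theta x <= f x) -> L theta <= a) ->
  pos_functional f <= a.
Proof.
move=> Cf H; apply: ge_sup; first by case: (pos_functional_has_sup Cf).
by move=> _ [theta [Ct tf] <-]; exact: H.
Qed.

(* Riesz decomposition: [theta <= f + g] is split into [theta f / (f + g + d)] and
   [theta g / (f + g + d)], up to an error [theta d / (f + g + d) <= d]. *)
Lemma pos_functionalD f g : C1b_ge0 f -> C1b_ge0 g ->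
  pos_functional (f \+ g) = pos_functional f + pos_functional g.
Proof.
move=> Cf Cg; have Cfg := C1b_ge0D hip Cf Cg; have f0 := Cf.2; have g0 := Cg.2.
have C0 : 0 <= C.
  by apply: le_trans (bndL (C1b_cst hip 0) _) => // x; rewrite normr0.
apply/eqP; rewrite eq_le; apply/andP; split; last first.
  rewrite -lerBrDr; apply: pos_functional_le => // s Cs sf.
  rewrite lerBrDr addrC -lerBrDr; apply: pos_functional_le => // t Ct tg.
  rewrite lerBrDr addrC -linL.1 ?(proj1 Cs) ?(proj1 Ct)//.
  - apply: pos_functional_ub => //; first exact: C1b_ge0D.
    by move=> x; apply: lerD.
  - by case: Cs.
  - by case: Ct.
apply: pos_functional_le => // t [Ct t0] tfg.
apply/ler_addgt0Pr => e e0.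
(* The error term is bounded by [d], hence its value under [L] by [C * d <= e]. *)
pose d : R := e / (C + 1).
have d0 : 0 < d by rewrite divr_gt0// ltr_wpDl.
have den x : d <= f x + g x + d by rewrite lerDr addr_ge0.
have den0 x : 0 < f x + g x + d by exact: lt_le_trans (den x).
have Cden : C1b_ge0 (fun x => (f x + g x + d)^-1).
  split; last by move=> x; rewrite invr_ge0 ltW.
  apply: (C1bV hip d0 den); apply: (C1bD hip _ (C1b_cst hip d)).
  by case: Cfg.
have Ctden : C1b_ge0 (fun x => t x * (f x + g x + d)^-1) by exact: C1b_ge0M.
pose s h := (fun x => t x * (f x + g x + d)^-1) \* h : X -> R.
have Cs h : C1b_ge0 h -> C1b_ge0 (s h) by move=> Ch; exact: C1b_ge0M.
have s_le x : t x * (f x + g x + d)^-1 <= 1.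
  rewrite ler_pdivrMr// mul1r (le_trans (tfg x))//= lerDl ltW//.
have tE : t = (s f \+ s g) \+ s (cst d).
  apply/funext => x; rewrite /s /= -!mulrDr -mulrA mulVf ?mulr1//.
  exact: lt0r_neq0.
have Csf := Cs _ Cf; have Csg := Cs _ Cg.
have Csd : C1b_ge0 (s (cst d)) by apply: Cs; apply: C1b_ge0_cst => //; exact: ltW.
rewrite tE !linL.1; [|by case: Csf|by case: Csg|by case: (C1b_ge0D hip Csf Csg)|by case: Csd].
apply: lerD; first apply: lerD.
- by apply: pos_functional_ub => // x; rewrite /s /= ler_piMl.
- by apply: pos_functional_ub => // x; rewrite /s /= ler_piMl.
- apply: le_trans (ler_norm _) _; apply: le_trans (functional_le Csd.1 d0 _) _.
    move=> x; rewrite ger0_norm; last by case: Csd.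
    by rewrite /s /= ler_piMl ?(ltW d0).
  rewrite /d mulrA ler_pdivrMr ?ltr_wpDl// mulrDr mulr1 mulrC lerDl.
  exact: ltW.
Qed.

Lemma pos_functionalZ a f : 0 <= a -> C1b_ge0 f ->
  pos_functional (fun x => a * f x) = a * pos_functional f.
Proof.
move=> a0 Cf; have f0 := Cf.2.
have Caf : C1b_ge0 (fun x => a * f x).
  by apply: (@C1b_ge0M _ _ _ hip (cst a)) => //; apply: C1b_ge0_cst.
have [a_eq0|a_neq0] := eqVneq a 0.
  rewrite a_eq0 mul0r; apply/eqP; rewrite eq_le; apply/andP; split.
    rewrite a_eq0 in Caf; apply: pos_functional_le => // t Ct tf.
    rewrite (_ : t = cst 0) ?functional0//; apply/funext => x.
    by apply/eqP; rewrite eq_le Ct.2 andbT (le_trans (tf x))// mul0r.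
  rewrite a_eq0 in Caf; rewrite -[leLHS]functional0; apply: pos_functional_ub => //.
    exact: C1b_ge0_cst.
  by move=> x; rewrite mul0r.
have a_gt0 : 0 < a by rewrite lt_neqAle eq_sym a_neq0.
apply/eqP; rewrite eq_le; apply/andP; split.
  apply: pos_functional_le => // t Ct tf.
  rewrite -ler_pdivrMl// -linL.2; last by case: Ct.
  apply: pos_functional_ub => //; last by move=> x; rewrite ler_pdivrMl.
  apply: (@C1b_ge0M _ _ _ hip (cst a^-1)) => //; apply: C1b_ge0_cst => //.
  by rewrite invr_ge0.
rewrite -ler_pdivlMl//; apply: pos_functional_le => // t Ct tf.
rewrite ler_pdivlMl// -linL.2; last by case: Ct.
apply: pos_functional_ub => //; last by move=> x; rewrite ler_wpM2l.
by apply: (@C1b_ge0M _ _ _ hip (cst a)) => //; apply: C1b_ge0_cst.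
Qed.

Hypothesis tightL : tight_functional L.

Lemma pos_functional_daniell : daniell_functional (ip := ip) pos_functional.
Proof.
split; [exact: pos_functionalD|exact: pos_functionalZ| |].
  move=> f Cf; rewrite -[leLHS]functional0; apply: pos_functional_ub => //.
    exact: C1b_ge0_cst.
  exact: Cf.2.
move=> f Cf df f_lim e e0; have [//|n fn] := tightL (f := f) _ e0.
exists n; apply: pos_functional_le => // t Ct tf.
apply: le_trans (ler_norm _) (fn t _ _) => [|x]; first by case: Ct.
by rewrite ger0_norm//; case: Ct.
Qed.

Lemma neg_functional_daniell :
  daniell_functional (ip := ip) (fun f => pos_functional f - L f).
Proof.
split.
- move=> f g Cf Cg; rewrite pos_functionalD// linL.1; first ring.
    by case: Cf.
  by case: Cg.
- by move=> a f a0 Cf; rewrite pos_functionalZ// linL.2 ?mulrBr//; case: Cf.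
- by move=> f Cf; rewrite subr_ge0; exact: pos_functional_ub.
move=> f Cf df f_lim e e0.
have e20 : 0 < e / 2 by rewrite divr_gt0.
have [//|n fn] := tightL (f := f) _ e20.
have fnL t : C1b_ge0 t -> (forall x, t x <= f n x) -> `|L t| <= e / 2.
  move=> [Ct t0] tf; apply: fn => // x; by rewrite ger0_norm.
exists n; rewrite [leRHS](splitr e); apply: lerD.
  by apply: pos_functional_le => // t Ct tf; apply: le_trans (ler_norm _) (fnL t _ _).
by apply: le_trans (ler_norm _) _; rewrite normrN; exact: fnL.
Qed.

Lemma signed_representation :
  exists lambda1 lambda2 : {finite_measure set (borelX X) -> \bar R},
    forall f, C1b_ge0 f ->
      (L f)%:E = (\int[lambda1]_x (f x)%:E - \int[lambda2]_x (f x)%:E)%E.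
Proof.
have [l1 l1E] := daniell_representation hip hsep pos_functional_daniell.
have [l2 l2E] := daniell_representation hip hsep neg_functional_daniell.
exists l1, l2 => f Cf; rewrite l1E// l2E// -EFinB; congr EFin; ring.
Qed.

End signed_functional.

(** * Integration against a fixed integrable weight *)

Section weighted_integral.
Context d {T : measurableType d} {R : realType} {mu : {measure set T -> \bar R}}.
Context {w : T -> R}.
Hypothesis intw : mu.-integrable [set: T] (EFin \o w).
Implicit Types k : T -> R.

Lemma measurable_weight : measurable_fun [set: T] w.
Proof. by apply/measurable_EFinP; exact: measurable_int intw. Qed.

Lemma integrable_weighted k M : measurable_fun [set: T] k -> (forall x, `|k x| <= M) ->
  mu.-integrable [set: T] (EFin \o (fun x => w x * k x)).
Proof.
move=> mk kM; apply: (@le_integrable _ _ _ mu _ _ _ (fun x => M%:E * (w x)%:E)%E) => //.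
- by apply/measurable_EFinP; apply: measurable_funM => //; exact: measurable_weight.
- move=> x _; rewrite /= lee_fin normrM mulrC.
  by rewrite [leRHS]normrM ler_wpM2r// (le_trans (kM x))// ler_norm.
- exact: integrableZl.
Qed.

Lemma weighted_integralD k1 k2 M1 M2 :
  measurable_fun [set: T] k1 -> (forall x, `|k1 x| <= M1) ->
  measurable_fun [set: T] k2 -> (forall x, `|k2 x| <= M2) ->
  (\int[mu]_x (w x * (k1 x + k2 x)) = \int[mu]_x (w x * k1 x) + \int[mu]_x (w x * k2 x))%R.
Proof.
move=> m1 b1 m2 b2; rewrite -RintegralD//; last 2 first.
- exact: integrable_weighted b1.
- exact: integrable_weighted b2.
by apply: eq_Rintegral => x _; rewrite mulrDr.
Qed.

Lemma weighted_integralZ a k M :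
  measurable_fun [set: T] k -> (forall x, `|k x| <= M) ->
  (\int[mu]_x (w x * (a * k x)) = a * \int[mu]_x (w x * k x))%R.
Proof.
move=> mk bk; rewrite -RintegralZl//; last exact: integrable_weighted bk.
by apply: eq_Rintegral => x _; rewrite mulrCA.
Qed.

Lemma weighted_integral_norm_le k M : measurable_fun [set: T] k -> (forall x, `|k x| <= M) ->
  (`|\int[mu]_x (w x * k x)| <= \int[mu]_x (`|w x| * `|k x|))%R.
Proof.
move=> mk bk; apply: le_trans (le_normr_Rintegral _ (integrable_weighted mk bk)) _ => //.
by under eq_Rintegral do rewrite normrM.
Qed.

(** Dominated convergence with dominating function [M * |w|]. It is used below with the weights [u],
    [|u|], [1] and [|u * v z|]. *)
Lemma weighted_integral_cvg (k : nat -> T -> R) (l : T -> R) M :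
  (forall n, measurable_fun [set: T] (k n)) -> (forall n x, `|k n x| <= M) ->
  measurable_fun [set: T] l -> (forall x, k n x @[n --> \oo] --> l x) ->
  (\int[mu]_x (w x * k n x))%R @[n --> \oo] --> (\int[mu]_x (w x * l x))%R.
Proof.
move=> mk bk ml kl.
have intl : mu.-integrable [set: T] (EFin \o (fun x => w x * l x)).
  apply: (@integrable_weighted _ M) => // x.
  have kx : `|k n x| @[n --> \oo] --> `|l x| by apply: cvg_norm; exact: kl.
  by rewrite -(cvg_lim _ kx)//; apply: limr_le; [exact: cvgP kx | exact: nearW].
have mwk n : measurable_fun [set: T] (fun x => (w x * k n x)%:E).
  by apply/measurable_EFinP; apply: measurable_funM => //; exact: measurable_weight.
have cvg_ae : {ae mu, forall x, [set: T] x ->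
    (fun n => (w x * k n x)%:E) @ \oo --> (w x * l x)%:E}.
  apply: aeW => x _; apply: cvg_EFin; first exact: nearW.
  by apply: cvgM; [exact: cvg_cst|exact: kl].
have dom : {ae mu, forall x n, [set: T] x -> (`|(w x * k n x)%:E| <= (M * `|w x|)%:E)%E}.
  by apply: aeW => x n _; rewrite /= lee_fin normrM mulrC ler_wpM2r.
have intMw : mu.-integrable [set: T] (fun x => (M * `|w x|)%:E).
  exact: (integrableZl measurableT M (integrable_norm intw)).
have [_ _] := dominated_convergence measurableT mwk (measurable_int mu intl) cvg_ae intMw dom.
rewrite -[X in _ --> X](fineK (integrable_fin_num _ intl))//.
exact: fine_cvg.
Qed.

End weighted_integral.

(** * Directional derivatives and averages of translates *)

Section directional.
Context {R : realType} {X : normedModType R} {ip : X -> X -> R}.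
Hypothesis hip : is_inner_product ip.
Notation C1b := (C1b (ip := ip)).
Implicit Types (f g : X -> R) (h x : X).

Lemma C1b_differentiable f x : C1b f -> differentiable f x.
Proof. by move=> [g [_ /(_ x)[]]]. Qed.

Lemma C1b_d_bounded f h : C1b f -> exists2 M : R, 0 <= M & forall x, `|'d f x h| <= M.
Proof.
move=> [g [_ d _ [M gM]]]; exists (`|M| * `|h|); first exact: mulr_ge0.
move=> x; rewrite (d x).2.
apply: le_trans (ip_norm_le hip _ _) _.
by rewrite ler_wpM2r// (le_trans (gM x))// ler_norm.
Qed.

Lemma C1b_d_continuous f h : C1b f -> continuous (fun x => 'd f x h).
Proof.
move=> [g [_ d cg _]] x.
rewrite (_ : (fun x => 'd f x h) = (fun x => ip (g x) h)).
  by apply: (@continuous_comp _ _ _ g (ip^~ h)); [exact: cg|exact: continuous_ipl].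
by apply/funext => y; rewrite (d y).2.
Qed.

Lemma C1b_d_measurable f h : C1b f -> measurable_fun [set: borelX X] (fun x => 'd f x h).
Proof. by move=> Cf; apply: continuous_borel_measurable; exact: C1b_d_continuous. Qed.

Lemma d_cst (a : R) h x : 'd (cst a : X -> R) x h = 0.
Proof. by rewrite diff_cst. Qed.

Lemma C1b_dD f g h x : C1b f -> C1b g -> 'd (f \+ g) x h = 'd f x h + 'd g x h.
Proof.
move=> Cf Cg.
exact: (congr1 (@^~ h) (diffD (C1b_differentiable x Cf) (C1b_differentiable x Cg))).
Qed.

Lemma C1b_dZ a f h x : C1b f -> 'd (fun x => a * f x) x h = a * 'd f x h.
Proof. by move=> Cf; exact: (congr1 (@^~ h) (diffZ a (C1b_differentiable x Cf))). Qed.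

Lemma C1b_d_shift f c h x : C1b f -> 'd (fun x => f (x + c)) x h = 'd f (x + c) h.
Proof.
move=> [g [_ d _ _]]; have [_ ->] := grad_shift c d x.
by rewrite (d (x + c)).2.
Qed.

Lemma C1b_d_sum (I : Type) (r : seq I) (F : I -> X -> R) h x : (forall i, C1b (F i)) ->
  'd (fun x => \sum_(i <- r) F i x) x h = \sum_(i <- r) 'd (F i) x h.
Proof.
move=> CF; elim: r => [|i r IH].
  by rewrite big_nil; under eq_fun do rewrite big_nil; exact: d_cst.
rewrite big_cons -IH -(C1b_dD h x (CF i) (C1b_sum hip r CF)).
by under eq_fun do rewrite big_cons.
Qed.

Lemma continuous_line x h : continuous (fun t : R => x + t *: h).
Proof.
move=> t; apply: cvgD; first exact: cvg_cst.
by apply: cvgZ; [exact: cvg_id|exact: cvg_cst].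
Qed.

Lemma C1b_d_line_continuous f h x : C1b f -> continuous (fun t : R => 'd f (x + t *: h) h).
Proof.
move=> Cf t.
apply: (@continuous_comp _ _ _ (fun t : R => x + t *: h) (fun y => 'd f y h)).
  exact: continuous_line.
exact: C1b_d_continuous.
Qed.

Lemma C1b_is_derive_line f h x (s : R) : C1b f ->
  is_derive s 1 (fun s => f (x + s *: h)) ('d f (x + s *: h) h).
Proof.
move=> Cf; have df := C1b_differentiable (x + s *: h) Cf.
have E : (fun t : R => t^-1 *: (((fun s => f (x + s *: h)) \o shift s) (t *: (1 : R)) -
    f (x + s *: h))) = (fun t => t^-1 *: ((f \o shift (x + s *: h)) (t *: h) - f (x + s *: h))).
  apply/funext => t /=; rewrite [t *: 1]mulr1; congr (_ *: (f _ - _)).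
  by rewrite scalerDl addrCA.
have dh := diff_derivable (v := h) df.
split; first by rewrite /derivable E.
by rewrite -deriveE// /derive E.
Qed.

Lemma C1b_line_MVT f h x (a b : R) : C1b f -> a <= b ->
  exists2 c, c \in `[a, b]%R &
    f (x + b *: h) - f (x + a *: h) = 'd f (x + c *: h) h * (b - a).
Proof.
move=> Cf ab.
have [|c cab E] := @MVT_segment R (fun s => f (x + s *: h)) (fun s => 'd f (x + s *: h) h)
    a b ab (fun s _ => C1b_is_derive_line h x s Cf).
  apply: continuous_subspaceT => s; apply: differentiable_continuous.
  by apply/derivable1_diffP; have D := C1b_is_derive_line h x s Cf; exact: ex_derive.
by exists c.
Qed.

Lemma C1b_line_lipschitz f h M : C1b f -> (forall x, `|'d f x h| <= M) ->
  forall x (a b : R), `|f (x + b *: h) - f (x + a *: h)| <= M * `|b - a|.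
Proof.
move=> Cf dM x a b; wlog ab : a b / a <= b => [H|].
  have [|/ltW] := leP a b; first exact: H.
  by move=> /H; rewrite distrC (distrC b).
have [c _ ->] := C1b_line_MVT h x Cf ab.
by rewrite normrM ler_wpM2r.
Qed.

(** * Difference quotients and averages along a segment *)

Definition diff_quotient h e f x : R := e^-1 * (f (x + e *: h) - f x).

Lemma C1b_diff_quotient h e f : C1b f -> C1b (diff_quotient h e f).
Proof. by move=> Cf; exact: (C1bZ hip e^-1 (C1bB hip (C1b_shift (e *: h) Cf) Cf)). Qed.

Lemma diff_quotient_cvg h f x : C1b f ->
  diff_quotient h n.+1%:R^-1 f x @[n --> \oo] --> 'd f x h.
Proof.
move=> Cf; apply/cvgrPdist_le => e e0.
have /cvgrPdist_le/(_ e e0) := @C1b_d_line_continuous f h x Cf 0.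
rewrite scale0r addr0.
move=> /nbhs_ballP[r /= r0 rP].
have : \forall n \near \oo, n.+1%:R^-1 < r := near_infty_natSinv_lt (PosNum r0).
apply: filterS => n nr.
have n0 : 0 < n.+1%:R^-1 :> R by rewrite invr_gt0.
have [c] := C1b_line_MVT h x Cf (ltW n0).
rewrite scale0r addr0 subr0 /diff_quotient in_itv/= => /andP[c0 cn] ->.
rewrite mulrCA mulVf ?lt0r_neq0// mulr1; apply: rP.
by rewrite -ball_normE /= sub0r normrN ger0_norm// (le_lt_trans cn).
Qed.

(** A Riemann sum for the mean of [f] over the segment from [x] to [x + e *: h]; being finite, it
    stays in [C1b] without differentiation under an integral. *)
Definition average_shift h e N f x : R :=
  N%:R^-1 * \sum_(k < N) f (x + (k%:R * (e / N%:R)) *: h).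

Lemma C1b_average_shift h e N f : C1b f -> C1b (average_shift h e N f).
Proof.
move=> Cf; have CF (k : 'I_N) : C1b (fun x => f (x + (k%:R * (e / N%:R)) *: h)).
  exact: C1b_shift.
exact: (C1bZ hip N%:R^-1 (C1b_sum hip _ CF)).
Qed.

Lemma d_average_shift h e N f x : C1b f ->
  'd (average_shift h e N f) x h =
  N%:R^-1 * \sum_(k < N) 'd f (x + (k%:R * (e / N%:R)) *: h) h.
Proof.
move=> Cf.
have CF (k : 'I_N) : C1b (fun x => f (x + (k%:R * (e / N%:R)) *: h)) by exact: C1b_shift.
rewrite C1b_dZ; last exact: (C1b_sum hip _ CF).
congr (_ * _); rewrite (C1b_d_sum _ _ _ CF).
by apply: eq_bigr => k _; rewrite C1b_d_shift.
Qed.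

Lemma average_shift_norm_le h e N f : (forall x, `|f x| <= 1) ->
  forall x, `|average_shift h e N.+1 f x| <= 1.
Proof.
move=> f1 x; rewrite normrM gtr0_norm ?invr_gt0// ler_pdivrMl// mulr1.
apply: le_trans (ler_norm_sum _ _ _) _.
apply: (@le_trans _ _ (\sum_(k < N.+1) 1)); first by apply: ler_sum.
by rewrite sumr_const card_ord.
Qed.

(* [diff_quotient h e f x] telescopes into the increments of [f] along the grid
   of mesh [e / N]; each is a value of the derivative, which is uniformly continuous
   on the segment. *)
Lemma d_average_shift_cvg h (e : R) f x : 0 < e -> C1b f ->
  'd (average_shift h e n.+1 f) x h @[n --> \oo] --> diff_quotient h e f x.
Proof.
move=> e0 Cf; apply/cvgrPdist_le => d d0.
pose F' (s : R) := 'd f (x + s *: h) h.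
have cF' : continuous F' by exact: C1b_d_line_continuous.
have [r r0 rP] : exists2 r, 0 < r & forall s t, s \in `[0, e]%R -> `|t - s| < r ->
    `|F' t - F' s| <= d.
  (* Compactness of [[0, e]], in near-covering form, turns continuity of [F'] at each [s] into a
     single radius [r]. *)
  have H : \forall r \near (0 : R)^'+, `[0, e]%classic `<=`
      (fun s => forall t, `|t - s| < r -> `|F' t - F' s| <= d).
    have /compact_near_coveringP cov := @segment_compact R 0 e.
    apply: cov => s _.
    have d20 : 0 < d / 2 by rewrite divr_gt0.
    have /cvgrPdist_le/(_ _ d20)/nbhs_ballP[r /= r0 rP] := cF' s.
    exists ([set s' | `|s' - s| < r / 2], [set r' | r' < r / 2]).
      split => /=; last exact: nbhs_right_lt (divr_gt0 r0 (@ltr0Sn R 1)).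
      apply/nbhs_ballP; exists (r / 2); first by rewrite /= divr_gt0.
      by move=> y; rewrite -ball_normE /= distrC.
    move=> [s' r'] /= [ss' r'r] t ts'.
    have sF y : `|y - s| < r -> `|F' y - F' s| <= d / 2.
      by move=> ys; rewrite distrC; apply: rP; rewrite -ball_normE /= distrC.
    rewrite (_ : F' t - F' s' = (F' t - F' s) - (F' s' - F' s)); last by ring.
    rewrite [leRHS]splitr; apply: le_trans (ler_normB _ _) _; apply: lerD; apply: sF.
      rewrite (_ : t - s = (t - s') + (s' - s)); last by ring.
      by rewrite (splitr r); apply: le_lt_trans (ler_normD _ _) _; rewrite ltrD// (lt_trans ts').
    by apply: lt_trans ss' _; rewrite ltr_pdivrMr// mulrDr mulr1 ltrDl.
  have : \forall r \near (0 : R)^'+, 0 < r /\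
      forall s, s \in `[0, e]%R -> forall t, `|t - s| < r -> `|F' t - F' s| <= d.
    near=> r; split; first by near: r; exact: nbhs_right_gt.
    by near: r; apply: filterS H => r' rP s sI; exact: (rP s sI).
  by move=> /filter_ex[r [r0 rP]]; exists r => // s t sI; exact: rP.
have er0 : 0 < r / e by rewrite divr_gt0.
have : \forall n \near \oo, n.+1%:R^-1 < r / e := near_infty_natSinv_lt (PosNum er0).
apply: filterS => n nr; rewrite d_average_shift// /diff_quotient.
set N : R := n.+1%:R; have N0 : 0 < N by rewrite ltr0n.
pose m := e / N; have m0 : 0 < m by rewrite divr_gt0.
have mr : m < r by move: nr; rewrite ltr_pdivlMr// mulrC.
pose G k := f (x + (k%:R * m) *: h).
have -> : f (x + e *: h) - f x = \sum_(k < n.+1) (G k.+1 - G k).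
  rewrite -(big_mkord xpredT (fun k => G k.+1 - G k)) telescope_sumr//.
  by rewrite /G mul0r scale0r addr0 /m mulrCA divff ?lt0r_neq0// mulr1.
have -> : N^-1 * \sum_(k < n.+1) 'd f (x + (k%:R * m) *: h) h =
    e^-1 * \sum_(k < n.+1) F' (k%:R * m) * m.
  by rewrite -mulr_suml /m; field; rewrite !lt0r_neq0.
rewrite -mulrBr normrM gtr0_norm ?invr_gt0// ler_pdivrMl// -sumrB.
apply: le_trans (ler_norm_sum _ _ _) _.
apply: (@le_trans _ _ (\sum_(k < n.+1) d * m)); last first.
  by rewrite sumr_const card_ord -mulr_natr -/N /m mulrA -mulrA mulVf ?lt0r_neq0// mulr1 mulrC.
apply: ler_sum => k _.
have kk : k%:R * m <= k.+1%:R * m by rewrite ler_wpM2r ?ler_nat// ltW.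
have [c] := C1b_line_MVT h x Cf kk.
rewrite /G in_itv/= => /andP[kc ck] ->.
have -> : k.+1%:R * m - k%:R * m = m by rewrite -natr1; ring.
rewrite -mulrBl normrM (gtr0_norm m0).
rewrite ler_wpM2r ?(ltW m0)// rP//.
  rewrite in_itv/= mulr_ge0 ?(ltW m0)//=.
  rewrite /m mulrA ler_pdivrMr// mulrC ler_wpM2l ?(ltW e0)//.
  by rewrite ler_nat ltnW.
rewrite ger0_norm ?subr_ge0// (le_lt_trans _ mr)// lerBlDr (le_trans ck)//.
by rewrite -natr1 mulrDl mul1r addrC.
Unshelve. all: by end_near. Qed.

End directional.

(** * Tightness of the distributional derivative *)

Section derivative_functional.
Context {R : realType} {X : normedModType R} {ip : X -> X -> R}.
Hypothesis hip : is_inner_product ip.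
Context {nu : {measure set (borelX X) -> \bar R}} {u : X -> R}.
Hypothesis intu : nu.-integrable [set: borelX X] (EFin \o u).
Context {h : X}.
Notation C1b := (C1b (ip := ip)).
Notation C1b_ge0 := (C1b_ge0 (ip := ip)).

Definition derivative_functional (f : X -> R) : R := \int[nu]_x (u x * 'd f x h).
Local Notation D := derivative_functional.

Lemma derivative_functional_linear : linear_functional (ip := ip) D.
Proof.
split=> [f g Cf Cg|a f Cf]; rewrite /D.
  have [M1 _ b1] := C1b_d_bounded hip h Cf; have [M2 _ b2] := C1b_d_bounded hip h Cg.
  rewrite -(weighted_integralD intu (C1b_d_measurable hip h Cf) b1
    (C1b_d_measurable hip h Cg) b2).
  by apply: eq_Rintegral => x _; rewrite (C1b_dD _ _ Cf Cg).
have [M _ b] := C1b_d_bounded hip h Cf.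
rewrite -(weighted_integralZ intu a (C1b_d_measurable hip h Cf) b).
by apply: eq_Rintegral => x _; rewrite (C1b_dZ _ _ _ Cf).
Qed.

(** In the limit the derivative disappears: [D] of an average depends only on the values of [f], so
    it tolerates changes of [f] on sets of small weight. *)
Lemma derivative_functional_average (e : R) f : 0 < e -> C1b f ->
  D (average_shift h e n.+1 f) @[n --> \oo] --> \int[nu]_x (u x * diff_quotient h e f x).
Proof.
move=> e0 Cf; have [M M0 fM] := C1b_d_bounded hip h Cf.
apply: (weighted_integral_cvg intu (M := M)).
- by move=> n; exact: (C1b_d_measurable hip h (C1b_average_shift hip h e n.+1 Cf)).
- move=> n x; rewrite (d_average_shift hip _ _ _ _ Cf) normrM gtr0_norm ?invr_gt0//.
  rewrite ler_pdivrMl//; apply: le_trans (ler_norm_sum _ _ _) _.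
  apply: (@le_trans _ _ (\sum_(k < n.+1) M)); first by apply: ler_sum.
  by rewrite sumr_const card_ord mulr_natl.
- apply: continuous_borel_measurable; exact: C1b_continuous (C1b_diff_quotient hip h e Cf).
- by move=> x; exact: (d_average_shift_cvg hip e0 Cf).
Qed.

Lemma derivative_functional_diff_quotient f : C1b f ->
  \int[nu]_x (u x * diff_quotient h n.+1%:R^-1 f x) @[n --> \oo] --> D f.
Proof.
move=> Cf; have [M M0 fM] := C1b_d_bounded hip h Cf.
apply: (weighted_integral_cvg intu (M := M)).
- move=> n; apply: continuous_borel_measurable.
  exact: C1b_continuous (C1b_diff_quotient hip h _ Cf).
- move=> n x; have n0 : 0 < n.+1%:R^-1 :> R by rewrite invr_gt0.
  rewrite /diff_quotient normrM (@gtr0_norm _ _^-1) ?invr_gt0// ler_pdivrMl// mulrC.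
  have := C1b_line_lipschitz Cf fM x 0 n.+1%:R^-1.
  by rewrite scale0r addr0 subr0 (gtr0_norm n0).
- exact: (C1b_d_measurable hip h Cf).
- by move=> x; exact: (diff_quotient_cvg hip Cf).
Qed.

(** The segment is two-sided because the cutoff looks back by up to [e] from both [x] and
    [x + e *: h]. *)
Definition small_segment (e eta : R) (f : X -> R) : set (borelX X) :=
  [set x | forall s, s \in `[- e, e]%R -> f (x + s *: h) <= eta].

(** The complement is a union of open sets, one for each [s], hence open, although the union is
    uncountable. *)
Lemma measurable_small_segment e eta f : continuous f ->
  measurable (small_segment e eta f).
Proof.
move=> cf; rewrite -[small_segment _ _ _]setCK; apply: measurableC.
apply: sub_sigma_algebra; rewrite /=.
have -> : ~` small_segment e eta f =
    \bigcup_(s in [set s | s \in `[- e, e]%R]) [set x | eta < f (x + s *: h)].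
  apply/seteqP; split => x.
    move=> /existsNP[s /not_implyP[sI /negP]]; rewrite -ltNge => fs.
    by exists s.
  by move=> [s /= sI fs] /(_ s sI); rewrite leNgt fs.
apply: bigcup_open => s _.
apply: (@open_comp _ _ (fun x => f (x + s *: h)) [set y | eta < y]); last exact: open_gt.
move=> x _; apply: (@continuous_comp _ _ _ (fun x => x + s *: h) f); last exact: cf.
by apply: cvgD; [exact: cvg_id|exact: cvg_cst].
Qed.

Lemma vanishing_sequence_le f m n x : vanishing_sequence (ip := ip) f ->
  (m <= n)%N -> f n x <= f m x.
Proof.
move=> [_ df _] /subnK <-; elim: (n - m)%N => [|k IH]; first by [].
by rewrite addSn; exact: le_trans (df _ _) IH.
Qed.

(** Dini's argument on a compact segment: smallness at one point and index extends to nearby points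
    by continuity and to later indices by monotonicity. *)
Lemma vanishing_small_segment f e eta x : vanishing_sequence (ip := ip) f -> 0 < eta ->
  \forall n \near \oo, small_segment e eta (f n) x.
Proof.
move=> vf eta0; have [Cf _ f_lim] := vf.
have /compact_near_coveringP cov := @segment_compact R (- e) e.
have : \forall n \near \oo, `[- e, e]%classic `<=` (fun s => f n (x + s *: h) <= eta).
  apply: cov => s _.
  have [n fn] := f_lim (x + s *: h) _ (divr_gt0 eta0 (@ltr0Sn R 1)).
  have cfn : continuous (fun t : R => f n (x + t *: h)).
    move=> t; apply: (@continuous_comp _ _ _ (fun t : R => x + t *: h) (f n)).
      exact: continuous_line.
    by apply: (C1b_continuous (ip := ip)); case: (Cf n).
  have fs : f n (x + s *: h) < eta.
    by apply: le_lt_trans fn _; rewrite ltr_pdivrMr// mulrDr mulr1 ltrDl.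
  exists ([set t | f n (x + t *: h) < eta], [set m | (n <= m)%N]).
    split => /=; last exact: nbhs_infty_ge.
    exact: (cvgr_lt _ (cfn s)).
  move=> [t m] /= [ft nm]; apply: le_trans (ltW ft).
  exact: vanishing_sequence_le.
by apply: filterS => n H s sI; exact: (H s sI).
Qed.

Lemma integrable_norm_weight :
  nu.-integrable [set: borelX X] (EFin \o (fun x => `|u x|)).
Proof. exact: integrable_norm intu. Qed.

Lemma vanishing_small_segment_integral f e eta : vanishing_sequence (ip := ip) f ->
  0 < eta ->
  \int[nu]_x (`|u x| * \1_(~` small_segment e eta (f n)) x) @[n --> \oo] --> (0 : R).
Proof.
move=> vf eta0; have [Cf _ _] := vf.
rewrite (_ : 0 = \int[nu]_x (`|u x| * cst 0 x)); last first.
  by under eq_Rintegral do rewrite mulr0; rewrite Rintegral_cst// mul0r.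
apply: (weighted_integral_cvg integrable_norm_weight (M := 1)) => //.
- move=> n; apply: measurable_indic; apply: measurableC; apply: measurable_small_segment.
  by apply: (C1b_continuous (ip := ip)); case: (Cf n).
- by move=> n x; rewrite indicE; case: (_ \in _); rewrite ?normr1 ?normr0.
- move=> x; apply: cvg_near_cst.
  apply: filterS (vanishing_small_segment e x vf eta0) => n sx.
  by rewrite indicE memNset.
Qed.

(** * The sliding hump argument *)

Context {C : R}.
Hypothesis bndD : bounded_functional (ip := ip) D C.

(** Near-optimality of [phi0] costs one [d], and each of the three replacements leading to [psi]
    another. *)
Let approx_chain (a b p q s d : R) : `|b - q| <= d -> `|p - q| <= d -> `|a - p| <= d ->
  s - d < b -> s - 4 * d <= a.
Proof.
rewrite !ler_norml => /andP[_ h1] /andP[h2 _] /andP[h3 _] h4; lra.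
Qed.

Let sandwich (p t s d m E : R) : s - 4 * d <= p -> s * (3 * m) <= E / 2 -> d = E / 8 ->
  p + 1 * t <= s * (1 + 3 * m) -> p + -1 * t <= s * (1 + 3 * m) -> `|t| <= E.
Proof. by move=> h1 h2 dE; rewrite dE in h1 => h3 h4; rewrite ler_norml; apply/andP; split; lra. Qed.

(* Sliding hump: let [S] be the norm of [D] and let [phi0] nearly attain it. If [f n] is
   small along the segments [x + [-e, e] h] for most [x], then [phi0] can be cut off
   where [f n] is large, and averaged over [[0, e] h], with little change of [D];
   the result [psi] has an essentially disjoint support from any [theta] with
   [`|theta| <= f n], so that [D psi + `|D theta|] cannot exceed [S] by much. *)
Lemma derivative_functional_tight_le1 f : vanishing_sequence (ip := ip) f ->
  (forall n x, f n x <= 1) -> forall E, 0 < E -> exists n, forall theta,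
  C1b theta -> (forall x, `|theta x| <= f n x) -> `|D theta| <= E.
Proof.
move=> vf f1 E E0; have [Cf _ _] := vf; have linD := derivative_functional_linear.
pose A := [set D phi | phi in [set phi | C1b phi /\ forall x, `|phi x| <= 1]].
have C10 : C1b (cst 0) by exact: C1b_cst.
have hsA : has_sup A.
  split; first by exists (D (cst 0)), (cst 0) => //; split => // x; rewrite normr0.
  by exists C => _ [phi [Cp p1] <-]; apply: le_trans (ler_norm _) (bndD Cp p1).
pose S := sup A.
have SA phi : C1b phi -> (forall x, `|phi x| <= 1) -> D phi <= S.
  by move=> Cp p1; apply: ub_le_sup; [case: hsA|exists phi].
have bndS : bounded_functional (ip := ip) D S.
  move=> phi Cp p1; rewrite ler_norml SA// andbT lerNl -mulN1r -linD.2//.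
  by apply: SA; [exact: C1bZ|move=> x; rewrite mulN1r normrN].
have S0 : 0 <= S by apply: le_trans (bndS _ C10 _) => // x; rewrite normr0.
(* The final bound is [4 * d + S * (3 * eta)], and each term is at most [E / 2]. *)
pose d : R := E / 8; have d0 : 0 < d by rewrite divr_gt0.
pose eta : R := E / (6 * (S + 1)).
have S60 : 0 < 6 * (S + 1) by apply: mulr_gt0 => //; rewrite ltr_wpDl.
have eta0 : 0 < eta by rewrite divr_gt0.
have [_ [phi0 [Cphi0 phi01] <-] Sphi0] := sup_adherent d0 hsA.
have [e e0 dq0] : exists2 e, 0 < e &
    `|D phi0 - \int[nu]_x (u x * diff_quotient h e phi0 x)| <= d.
  have /cvgrPdist_le/(_ d d0) := derivative_functional_diff_quotient Cphi0.
  by move=> /filter_ex[n nd]; exists n.+1%:R^-1 => //; rewrite invr_gt0.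
(* Off the small segments the difference quotients of [kappa] and [phi0] will differ by at most
   [2 / e], elsewhere not at all; the threshold [d * e / 2] turns this into [d]. *)
have [n un] : exists n, \int[nu]_x (`|u x| * \1_(~` small_segment e eta (f n)) x) <= d * e / 2.
  have de0 : 0 < d * e / 2 by rewrite divr_gt0// mulr_gt0.
  have /cvgrPdist_le/(_ _ de0) := vanishing_small_segment_integral e vf eta0.
  move=> /filter_ex[n nd]; exists n; apply: le_trans (ler_norm _) _.
  by rewrite -normrN -[X in `|X|]add0r.
exists n => theta Ctheta thetaf.
have [l l0 fl] := C1b_d_bounded hip h (Cf n).1.
(* The grid is so fine that [f n], which is [l]-Lipschitz along [h], varies by at most [eta] between
   neighbouring grid points. *)
have [m lm] : exists m, l * (e / m.+1%:R) <= eta.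
  have [m me] := exists_natSinv_lt (divr_gt0 eta0 (ltr_wpDl (mulr_ge0 l0 (ltW e0)) ltr01)).
  exists m; rewrite mulrA; move: me; rewrite ltr_pdivlMr ?ltr_wpDl ?mulr_ge0 ?(ltW e0)//.
  move=> /ltW; apply: le_trans; rewrite mulrC ler_wpM2l ?invr_ge0// lerDl//.
pose m1 : R := m.+1%:R; have m10 : 0 < m1 by rewrite ltr0n.
(* There are [m.+2] indices so that both endpoints [0] and [e] are grid points. *)
pose s (j : 'I_m.+2) : R := j%:R * (e / m1).
(* The factor is [1] where [f n] is at most [eta] at the point shifted back by [s j], and [0] where
   it is at least [2 * eta]. *)
pose fac (j : 'I_m.+2) x := 1 - smoothstep (eta^-1 * f n (x + (- s j) *: h) + -1).
pose chi x := \prod_j fac j x.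
have Cchi : C1b chi.
  apply: (@C1b_prod _ _ _ hip _ _ fac) => j; apply: (C1bB hip (C1b_cst hip 1)).
  apply: (C1b_smoothstep hip); apply: (C1b_affine hip).
  by apply: C1b_shift; case: (Cf n).
have fac01 j x : 0 <= fac j x <= 1.
  by rewrite subr_ge0 smoothstep_le1/= gerBl smoothstep_ge0.
have chi01 x : 0 <= chi x <= 1.
  apply/andP; split; first by apply: prodr_ge0 => j _; case/andP: (fac01 j x).
  by apply: prodr_ile1 => j _; exact: fac01.
have chi1 x : (forall j, f n (x + (- s j) *: h) <= eta) -> chi x = 1.
  move=> H; apply: big1 => j _; rewrite /fac smoothstep0 ?subr0//.
  by rewrite subr_le0 ler_pdivrMl// mulr1.
have chi_neq0 x j : chi x != 0 -> f n (x + (- s j) *: h) <= 2 * eta.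
  rewrite leNgt; apply: contra => H; rewrite /chi (bigD1 j)//= /fac smoothstep1.
    by rewrite subrr mul0r.
  by rewrite lerBrDr ler_pdivlMl// mulrC ltW.
pose kappa := phi0 \* chi.
have Ckappa : C1b kappa by exact: C1bM.
have kappa1 x : `|kappa x| <= 1.
  have /andP[c0 c1] := chi01 x; rewrite normrM (ger0_norm c0).
  by rewrite -[leRHS]mulr1 ler_pM.
have kphi x : `|kappa x - phi0 x| <= 1.
  have /andP[c0 c1] := chi01 x.
  rewrite /kappa /= -[X in _ - X]mulr1 -mulrBr normrM -[leRHS]mulr1 ler_pM//.
  by rewrite distrC ger0_norm ?subr_ge0// gerBl.
have sj j : 0 <= s j <= e.
  rewrite /s mulr_ge0 ?divr_ge0 ?(ltW e0) ?(ltW m10)//= mulrCA ger_pMr//.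
  by rewrite ler_pdivrMr// mul1r ler_nat -ltnS.
have kE x : small_segment e eta (f n) x -> kappa x = phi0 x /\ 
    kappa (x + e *: h) = phi0 (x + e *: h).
  move=> xE; rewrite /kappa /= !chi1 ?mulr1//.
    move=> j; rewrite -addrA -scalerDl; apply: xE; rewrite in_itv/=.
    have /andP[s0 se] := sj j; apply/andP; split; last by rewrite gerDl oppr_le0.
    by rewrite -[leLHS]add0r lerD ?(ltW e0)// lerN2.
  move=> j; apply: xE; rewrite in_itv/=; have /andP[s0 se] := sj j.
  by rewrite lerN2 se/= (le_trans _ (ltW e0))// oppr_le0.
have dqk_le x : `|diff_quotient h e kappa x - diff_quotient h e phi0 x| <=
    2 / e * \1_(~` small_segment e eta (f n)) x.
  rewrite /diff_quotient -mulrBr normrM gtr0_norm ?invr_gt0//.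
  rewrite [leRHS]mulrAC -[leRHS]mulrC ler_wpM2l ?invr_ge0 ?(ltW e0)//.
  have -> : kappa (x + e *: h) - kappa x - (phi0 (x + e *: h) - phi0 x) =
    (kappa (x + e *: h) - phi0 (x + e *: h)) - (kappa x - phi0 x) by ring.
  have [xE|xE] := pselect (small_segment e eta (f n) x).
    have [-> ->] := kE x xE; rewrite !subrr normr0.
    by rewrite mulr_ge0// indicE.
  rewrite indicE mem_set// mulr1; apply: le_trans (ler_normB _ _) _.
  by rewrite -[leRHS]/(1 + 1) lerD.
have mseg : measurable (~` small_segment e eta (f n)).
  apply: measurableC; apply: measurable_small_segment.
  by apply: (C1b_continuous (ip := ip)); case: (Cf n).
have mdq phi : C1b phi -> measurable_fun [set: borelX X] (diff_quotient h e phi).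
  move=> Cphi; apply: continuous_borel_measurable.
  exact: C1b_continuous (C1b_diff_quotient hip h e Cphi).
have dqk : `|\int[nu]_x (u x * diff_quotient h e kappa x) -
    \int[nu]_x (u x * diff_quotient h e phi0 x)| <= d.
  have [M1 b1] := C1b_bounded (C1b_diff_quotient hip h e Ckappa).
  have [M2 b2] := C1b_bounded (C1b_diff_quotient hip h e Cphi0).
  have mB : measurable_fun [set: borelX X]
      (fun x => diff_quotient h e kappa x - diff_quotient h e phi0 x).
    by apply: measurable_funB; exact: mdq.
  have bB x : `|diff_quotient h e kappa x - diff_quotient h e phi0 x| <= M1 + M2.
    by apply: le_trans (ler_normB _ _) _; rewrite lerD.
  have i1 x : `|\1_(~` small_segment e eta (f n)) x : R| <= 1.
    by rewrite indicE; case: (_ \in _); rewrite ?normr1 ?normr0.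
  have e20 : 0 <= 2 / e by rewrite divr_ge0// ltW.
  have bI x : `|2 / e * \1_(~` small_segment e eta (f n)) x : R| <= 2 / e.
    by rewrite normrM (ger0_norm e20) ler_piMr.
  have mI : measurable_fun [set: borelX X]
      (fun x => 2 / e * \1_(~` small_segment e eta (f n)) x : R).
    by apply: measurable_funM => //; exact: measurable_indic.
  rewrite -RintegralB//; last 2 first.
  - exact: (integrable_weighted intu (mdq _ Ckappa) b1).
  - exact: (integrable_weighted intu (mdq _ Cphi0) b2).
  under eq_Rintegral do rewrite -mulrBr.
  apply: le_trans (weighted_integral_norm_le intu mB bB) _.
  apply: (@le_trans _ _ (\int[nu]_x (`|u x| * (2 / e * \1_(~` small_segment e eta (f n)) x)))).
    apply: le_Rintegral => //.
    - apply: (integrable_weighted integrable_norm_weight (M := M1 + M2)).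
        exact: measurableT_comp.
      by move=> x; rewrite normr_id.
    - exact: (integrable_weighted integrable_norm_weight mI bI).
    - by move=> x _; rewrite ler_wpM2l.
  rewrite (weighted_integralZ integrable_norm_weight (2 / e) (measurable_indic mseg) i1).
  rewrite -ler_pdivlMl ?divr_gt0//; apply: le_trans un _.
  by rewrite le_eqVlt; apply/orP; left; apply/eqP; field; rewrite lt0r_neq0.
have [N psiN] : exists N, `|D (average_shift h e N.+1 kappa) -
    \int[nu]_x (u x * diff_quotient h e kappa x)| <= d.
  have /cvgrPdist_le/(_ d d0) := derivative_functional_average e0 Ckappa.
  by move=> /filter_ex[N Nd]; exists N; rewrite distrC.
set psi := average_shift h e N.+1 kappa in psiN.
have Cpsi : C1b psi by exact: C1b_average_shift.
have psi1 x : `|psi x| <= 1 by exact: average_shift_norm_le.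
have psi_supp x : psi x != 0 -> f n x <= 3 * eta.
  move=> psix.
  have [k kapk] : exists k : 'I_N.+1, kappa (x + (k%:R * (e / N.+1%:R)) *: h) != 0.
    apply: contrapT => /forallNP H; move/eqP: psix; apply.
    rewrite /psi /average_shift big1 ?mulr0// => k _.
    by have /negP := H k; rewrite negbK => /eqP.
  (* The quotient is the index of the last grid point not beyond the [k]-th shift of the average.
     The two differ by at most [e / m1], so [2 * eta] at the shifted point becomes [3 * eta] at
     [x]. *)
  have kN : (k * m.+1 %/ N.+1 < m.+2)%N.
    rewrite ltn_divLR//; apply: (@leq_ltn_trans (N.+1 * m.+1)).
      by rewrite leq_mul2r ltnW ?orbT.
    by rewrite mulnC ltn_pmul2r.
  pose j : 'I_m.+2 := Ordinal kN; pose N1 : R := N.+1%:R.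
  have N10 : 0 < N1 by rewrite ltr0n.
  have jN : j%:R * N1 <= k%:R * m1 by rewrite -!natrM ler_nat leq_divM.
  have Nj : k%:R * m1 <= (j%:R + 1) * N1.
    by rewrite natr1 -!natrM ler_nat ltnW// ltn_ceil.
  have := chi_neq0 (x + (k%:R * (e / N1)) *: h) j.
  have -> : chi (x + (k%:R * (e / N1)) *: h) != 0.
    by apply: contra kapk => /eqP c0; rewrite /kappa /= c0 mulr0.
  move=> /(_ isT); rewrite -addrA -scalerDl.
  set a := k%:R * (e / N1) - s j => fa.
  have aE : a = e * (k%:R * m1 - j%:R * N1) / (N1 * m1).
    by rewrite /a /s; field; rewrite !lt0r_neq0.
  have a0 : 0 <= a by rewrite aE divr_ge0 ?mulr_ge0 ?subr_ge0 ?(ltW e0) ?(ltW N10) ?(ltW m10).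
  have ae : a <= e / m1.
    have -> : e / m1 = e * N1 / (N1 * m1) by field; rewrite !lt0r_neq0.
    rewrite aE ler_pM2r ?invr_gt0 ?mulr_gt0// ler_pM2l//.
    by rewrite lerBlDl -[X in _ + X]mul1r -mulrDl.
  have := C1b_line_lipschitz (Cf n).1 fl x a 0.
  rewrite scale0r addr0 sub0r normrN (ger0_norm a0) => /(le_trans (ler_norm _)).
  rewrite lerBlDr => /le_trans; apply.
  have -> : 3 * eta = eta + 2 * eta by ring.
  by apply: lerD => //; apply: le_trans lm; rewrite ler_wpM2l.
have Seta : S * (3 * eta) <= E / 2.
  rewrite /eta (_ : S * _ = S * E / (2 * (S + 1))); last first.
    by field; apply: lt0r_neq0; rewrite ltr_wpDl.
  rewrite ler_pdivrMr ?mulr_gt0 ?ltr_wpDl//.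
  have -> : E / 2 * (2 * (S + 1)) = S * E + E by field.
  by rewrite lerDl ltW.
have dpsi : S - 4 * d <= D psi := approx_chain dq0 dqk psiN Sphi0.
have dE : d = E / 8 by [].
clear dq0 dqk psiN dqk_le kE chi_neq0 chi1 Sphi0 un lm; clearbody psi S d eta.
(* Where [psi] vanishes, [theta] is at most [1]; elsewhere [theta] is at most [3 * eta]. Hence
   [psi + sg * theta] has sup norm at most [1 + 3 * eta]. *)
have key sg : `|sg| = 1 -> D psi + sg * D theta <= S * (1 + 3 * eta).
  move=> sg1; have Csg := C1bZ hip sg Ctheta.
  rewrite -(linD.2 sg theta Ctheta) -(linD.1 _ _ Cpsi Csg).
  apply: le_trans (ler_norm _) _.
  apply: (functional_le hip linD bndS (C1bD hip Cpsi Csg)).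
    by rewrite ltr_wpDr// mulr_ge0// ltW.
  move=> x; have [psix|psix] := eqVneq (psi x) 0.
    rewrite /= psix add0r normrM sg1 mul1r (le_trans (thetaf x))// (le_trans (f1 n x))//.
    by rewrite lerDl mulr_ge0// ltW.
  apply: le_trans (ler_normD _ _) _; apply: lerD => //.
  by rewrite normrM sg1 mul1r (le_trans (thetaf x))// psi_supp.
exact: (sandwich dpsi Seta dE (key 1 (normr1 _)) (key (-1) (normrN1 _))).
Qed.

(** A bound for [f 0] bounds the whole decreasing sequence, and dividing by it reduces to functions
    below [1]. *)
Lemma derivative_functional_tight : tight_functional (ip := ip) D.
Proof.
move=> f vf E E0; have [Cf df f_lim] := vf.
have linD := derivative_functional_linear.
have [M fM] := C1b_bounded (Cf 0%N).1.
pose b := `|M| + 1; have b0 : 0 < b by rewrite ltr_wpDl.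
pose g n x := b^-1 * f n x.
have vg : vanishing_sequence (ip := ip) g.
  split.
  - move=> n; apply: (@C1b_ge0M _ _ _ hip (cst b^-1)) => //; apply: (C1b_ge0_cst hip).
    by rewrite invr_ge0 ltW.
  - by move=> n x; rewrite ler_wpM2l// invr_ge0 ltW.
  - move=> x r r0; have [n fn] := f_lim x _ (mulr_gt0 b0 r0).
    by exists n; rewrite /g ler_pdivrMl.
have g1 n x : g n x <= 1.
  rewrite /g ler_pdivrMl// mulr1 (le_trans (vanishing_sequence_le x vf (leq0n n)))//.
  rewrite (le_trans (ler_norm _))// (le_trans (fM x))// (le_trans (ler_norm _))//.
  by rewrite lerDl.
have Eb0 : 0 < E / b by rewrite divr_gt0.
have [n gn] := derivative_functional_tight_le1 vg g1 Eb0.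
exists n => theta Ct tf; have := gn _ (C1bZ hip b^-1 Ct).
rewrite linD.2// normrM gtr0_norm ?invr_gt0// ler_pdivrMl// mulrCA divff ?lt0r_neq0//.
rewrite mulr1; apply => x.
by rewrite normrM gtr0_norm ?invr_gt0// /g ler_pM2l ?invr_gt0.
Qed.

End derivative_functional.

(** * Approximation of Borel sets by [C1b] functions *)

Section approximation.
Context {R : realType} {X : normedModType R} {ip : X -> X -> R}.
Hypothesis hip : is_inner_product ip.
Hypothesis hsep : separable X.
Context {tau : {measure set (borelX X) -> \bar R}}.
Hypothesis tau_fin : (tau [set: borelX X] < +oo)%E.
Notation C1b := (C1b (ip := ip)).
Implicit Types (f g : borelX X -> R) (A : set (borelX X)).

Lemma bounded_integrable f M : measurable_fun [set: borelX X] f -> (forall x, `|f x| <= M) ->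
  tau.-integrable [set: borelX X] (EFin \o f).
Proof.
move=> mf fM; apply: measurable_bounded_integrable => //.
exists `|M|; split; first exact: num_real.
by move=> y My x _; apply: le_trans (fM x) (le_trans (ler_norm _) (ltW My)).
Qed.

Definition unit_fun f := measurable_fun [set: borelX X] f /\ forall x, 0 <= f x <= 1.

Lemma unit_fun_indic A : measurable A -> unit_fun \1_A.
Proof.
by move=> mA; split; [exact: measurable_indic|move=> x; rewrite indicE; case: (_ \in _); rewrite /= lexx ler01].
Qed.

Lemma unit_fun_C1b f : C1b f -> (forall x, 0 <= f x <= 1) -> unit_fun f.
Proof.
by move=> Cf f01; split => //; apply: continuous_borel_measurable; exact: C1b_continuous Cf.
Qed.

Let unit_fun_dist f g : unit_fun f -> unit_fun g ->
  measurable_fun [set: borelX X] (fun x => `|f x - g x|) /\ forall x, `|(`|f x - g x|)| <= 1.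
Proof.
move=> [mf f01] [mg g01]; split.
  by apply: measurableT_comp => //; exact: measurable_funB.
move=> x; rewrite normr_id ler_norml.
by have /andP[? ?] := f01 x; have /andP[? ?] := g01 x; apply/andP; split; lra.
Qed.

Definition L1dist f g : R := \int[tau]_x `|f x - g x|.

Lemma le_L1dist f g f1 g1 f2 g2 : unit_fun f -> unit_fun g ->
  unit_fun f1 -> unit_fun g1 -> unit_fun f2 -> unit_fun g2 ->
  (forall x, `|f x - g x| <= `|f1 x - g1 x| + `|f2 x - g2 x|) ->
  L1dist f g <= L1dist f1 g1 + L1dist f2 g2.
Proof.
move=> uf ug uf1 ug1 uf2 ug2 H.
have [m b] := unit_fun_dist uf ug; have [m1 b1] := unit_fun_dist uf1 ug1.
have [m2 b2] := unit_fun_dist uf2 ug2.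
have i1 := bounded_integrable m1 b1; have i2 := bounded_integrable m2 b2.
rewrite -RintegralD//; apply: le_Rintegral => //; first exact: bounded_integrable m b.
by have := integrableD measurableT i1 i2; apply: eq_integrable.
Qed.

Lemma L1dist_cvg0 (f : nat -> borelX X -> R) g : (forall n, unit_fun (f n)) -> unit_fun g ->
  (forall x, f n x @[n --> \oo] --> g x) -> L1dist (f n) g @[n --> \oo] --> (0 : R).
Proof.
move=> uf ug fg.
have int1 : tau.-integrable [set: borelX X] (EFin \o cst 1).
  by apply: (@bounded_integrable _ 1) => // x; rewrite normr1.
rewrite (_ : (fun n => L1dist (f n) g) =
    (fun n => \int[tau]_x (cst 1 x * `|f n x - g x|))); last first.
  by apply/funext => n; apply: eq_Rintegral => x _; rewrite mul1r.
rewrite (_ : 0 = \int[tau]_x (cst 1 x * cst 0 x)); last first.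
  by under eq_Rintegral do rewrite mulr0; rewrite Rintegral_cst// mul0r.
apply: (weighted_integral_cvg int1 (M := 1)) => //.
- by move=> n; case: (unit_fun_dist (uf n) ug).
- by move=> n; case: (unit_fun_dist (uf n) ug).
- move=> x; rewrite /= -(normr0 R) -(subrr (g x)).
  by apply: cvg_norm; apply: cvgB; [exact: fg|exact: cvg_cst].
Qed.

Definition C1b_approximable A := forall d, 0 < d -> exists chi,
  [/\ C1b chi, forall x, 0 <= chi x <= 1 & L1dist chi \1_A <= d].

Lemma C1b_approximable_limit (A : nat -> set (borelX X)) B :
  (forall n, measurable (A n)) -> measurable B ->
  (forall x, \1_(A n) x @[n --> \oo] --> (\1_B x : R)) ->
  (forall n, C1b_approximable (A n)) -> C1b_approximable B.
Proof.
move=> mA mB AB aA d d0; have d20 : 0 < d / 2 by rewrite divr_gt0.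
have uA n := unit_fun_indic (mA n); have uB := unit_fun_indic mB.
have /cvgrPdist_le/(_ _ d20)/filter_ex[n nd] := L1dist_cvg0 uA uB AB.
have [chi [Cchi chi01 chid]] := aA n _ d20.
exists chi; split => //; have uchi := unit_fun_C1b Cchi chi01.
apply: (@le_trans _ _ (L1dist chi \1_(A n) + L1dist \1_(A n) \1_B)).
  apply: le_L1dist => // x.
  by rewrite (_ : chi x - _ = (chi x - \1_(A n) x) + (\1_(A n) x - \1_B x));
    [exact: ler_normD|ring].
rewrite [leRHS]splitr lerD//; apply: le_trans nd.
by rewrite sub0r normrN ler_norm.
Qed.

Lemma C1b_approximableC A : C1b_approximable A -> C1b_approximable (~` A).
Proof.
move=> aA d d0; have [chi [Cchi chi01 chid]] := aA d d0.
exists (fun x => 1 - chi x); split.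
- exact: (C1bB hip (C1b_cst hip 1) Cchi).
- by move=> x; have /andP[c0 c1] := chi01 x; rewrite subr_ge0 c1/= gerBl.
- apply: le_trans chid; rewrite le_eqVlt; apply/orP; left; apply/eqP.
  apply: eq_Rintegral => x _; rewrite -normrN; congr `|_|.
  rewrite !indicE in_setC; case: (x \in A); rewrite /=; ring.
Qed.

(** Indicators satisfy the formula [1 - (1 - s) * (1 - t)] for unions, and on [[0, 1]] it is
    1-Lipschitz in each argument, so the errors add. *)
Lemma C1b_approximableU A B : measurable A -> measurable B ->
  C1b_approximable A -> C1b_approximable B -> C1b_approximable (A `|` B).
Proof.
move=> mA mB aA aB d d0; have d20 : 0 < d / 2 by rewrite divr_gt0.
have [s [Cs s01 sd]] := aA _ d20; have [t [Ct t01 td]] := aB _ d20.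
pose chi x := 1 - (1 - s x) * (1 - t x).
have Cchi : C1b chi.
  apply: (C1bB hip (C1b_cst hip 1)); apply: (C1bM hip).
    exact: (C1bB hip (C1b_cst hip 1) Cs).
  exact: (C1bB hip (C1b_cst hip 1) Ct).
have chi01 x : 0 <= chi x <= 1.
  have /andP[s0 s1] := s01 x; have /andP[t0 t1] := t01 x.
  by rewrite /chi; apply/andP; split; nra.
exists chi; split => //; rewrite (splitr d).
apply: le_trans (lerD sd td).
apply: (le_L1dist (unit_fun_C1b Cchi chi01) (unit_fun_indic (measurableU _ _ mA mB))
  (unit_fun_C1b Cs s01) (unit_fun_indic mA) (unit_fun_C1b Ct t01) (unit_fun_indic mB)) => x.
have /andP[s0 s1] := s01 x; have /andP[t0 t1] := t01 x.
have st0 : 0 <= (1 - s x) * (1 - t x) by rewrite mulr_ge0// subr_ge0.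
rewrite /chi !indicE in_setU.
have s1E : `|s x - 1| = 1 - s x by rewrite distrC ger0_norm ?subr_ge0.
have t1E : `|t x - 1| = 1 - t x by rewrite distrC ger0_norm ?subr_ge0.
case: (x \in A); case: (x \in B);
  rewrite /= ?mulr1n ?mulr0n ?subr0 ?s1E ?t1E ?(ger0_norm s0) ?(ger0_norm t0) ler_norml;
  by apply/andP; split; nra.
Qed.

Lemma C1b_approximable0 : C1b_approximable set0.
Proof.
move=> d d0; exists (cst 0); split.
- exact: C1b_cst.
- by move=> x; rewrite lexx ler01.
- rewrite /L1dist; under eq_Rintegral do rewrite indic0 subrr normr0.
  by rewrite Rintegral_cst// mul0r ltW.
Qed.

Lemma C1b_approximable_bigcup (A : nat -> set (borelX X)) :
  (forall n, measurable (A n)) -> (forall n, C1b_approximable (A n)) ->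
  C1b_approximable (\bigcup_n A n).
Proof.
move=> mA aA; pose B n := \big[setU/set0]_(k < n) A k.
have mB n : measurable (B n) by exact: bigsetU_measurable.
apply: (C1b_approximable_limit mB) => [|x|n].
- exact: bigcupT_measurable.
- apply: cvg_near_cst.
  have [[k _ Akx]|nAx] := pselect ((\bigcup_n A n) x).
    have Ax : (\bigcup_n A n) x by exists k.
    exists k.+1 => // n /= kn; have Bx : B n x by rewrite /B -bigcup_mkord; exists k.
    by rewrite !indicE (mem_set Ax) (mem_set Bx).
  apply: nearW => n.
  have nBx : ~ B n x by rewrite /B -bigcup_mkord => -[k _ Akx]; apply: nAx; exists k.
  by rewrite !indicE (memNset nAx) (memNset nBx).
- rewrite /B; elim: n => [|n IH].
    by rewrite big_ord0; exact: C1b_approximable0.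
  by rewrite big_ord_recr/=; apply: C1b_approximableU => //; exact: bigsetU_measurable.
Qed.

Lemma measurable_ball_bump c r :
  measurable ([set x | 0 < ball_bump c r x] : set (borelX X)).
Proof.
apply: sub_sigma_algebra.
apply: (@open_comp _ _ (ball_bump c r) [set y | 0 < y]); last exact: open_gt.
by move=> x _; exact: (C1b_continuous (C1b_ball_bump hip c r)).
Qed.

Lemma C1b_approximable_ball c r : 0 < r ->
  C1b_approximable [set x | 0 < ball_bump c r x].
Proof.
move=> r0 d d0; pose q := ball_bump c r.
have Cq : C1b q by exact: C1b_ball_bump.
pose chi n x := smoothstep (n%:R * q x + 0).
have Cchi n : C1b (chi n) by exact: (C1b_smoothstep hip (C1b_affine hip n%:R 0 Cq)).
have chi01 n x : 0 <= chi n x <= 1 by rewrite smoothstep_ge0 smoothstep_le1.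
have mA : measurable ([set x | 0 < q x] : set (borelX X)).
  exact: measurable_ball_bump.
have /cvgrPdist_le/(_ d d0)/filter_ex[n nd] :
    L1dist (chi n) \1_[set x | 0 < q x] @[n --> \oo] --> (0 : R).
  apply: L1dist_cvg0; [by move=> n; exact: unit_fun_C1b|exact: unit_fun_indic|].
  move=> x; rewrite indicE; apply: cvg_near_cst.
  have [qx|qx] := ltP 0 (q x); last first.
    have nqx : ~ [set x | 0 < q x] x by rewrite /= ltNge qx.
    apply: nearW => n; rewrite (memNset nqx) /chi smoothstep0//.
    by rewrite addr0 mulr_ge0_le0.
  have [k kq] := exists_natSinv_lt qx.
  exists k.+1 => // n /= kn; rewrite mem_set// /chi smoothstep1// addr0.
  rewrite -ler_pdivrMr// mul1r -lef_pV2 ?posrE ?invr_gt0 ?ltr0n//; last exact: leq_ltn_trans kn.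
  rewrite invrK; apply: le_trans (ltW kq).
  by rewrite lef_pV2 ?posrE ?ltr0n ?ler_nat//; exact: leq_ltn_trans kn.
exists (chi n); split => //; apply: le_trans nd.
by rewrite sub0r normrN ler_norm.
Qed.

(** The approximable sets form a sigma-algebra containing the balls; [G] carries measurability along
    because the steps for unions use it. *)
Lemma C1b_approximation A : measurable A -> C1b_approximable A.
Proof.
pose G := [set B : set (borelX X) | measurable B /\ C1b_approximable B].
suff GA : measurable `<=` G by move=> /GA[].
have sG : sigma_algebra [set: X] G.
  split.
  - by split; [exact: measurable0|exact: C1b_approximable0].
  - move=> B [mB aB]; rewrite setTD; split; first exact: measurableC.
    exact: C1b_approximableC.
  - move=> F FG; split; first by apply: bigcupT_measurable => n; case: (FG n).
    by apply: C1b_approximable_bigcup => n; case: (FG n).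
apply: smallest_sub => // U oU; apply: (open_ball_bump_sigma_algebra hsep sG) oU => c r r0.
split; last exact: C1b_approximable_ball.
exact: measurable_ball_bump.
Qed.

End approximation.

(** * Charges *)

Section charge.
Context {R : realType} {X : normedModType R}.
Implicit Types (m : {charge set (borelX X) -> \bar R}) (f : borelX X -> R).

Let fin_measure_lty (mu : {finite_measure set (borelX X) -> \bar R}) :
  (mu [set: borelX X] < +oo)%E.
Proof. by rewrite ltey_eq fin_num_measure. Qed.

Let fin_numE (x : \bar R) : x \is a fin_num -> exists a, x = a%:E.
Proof. by move=> xfin; exists (fine x); rewrite fineK. Qed.

(** The identity [m = l1 - l2] is rewritten as equality of the positive measures [jordan_pos + l2]
    and [l1 + jordan_neg], which is integrated and rearranged. *)
Lemma jordan_integralB m P N (NN : hahn_decomposition m P N)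
    (l1 l2 : {finite_measure set (borelX X) -> \bar R}) f M :
  measurable_fun [set: borelX X] f -> (forall x, `|f x| <= M) ->
  (forall A, measurable A -> m A = l1 A - l2 A)%E ->
  (\int[jordan_pos NN]_x (f x)%:E - \int[jordan_neg NN]_x (f x)%:E =
   \int[l1]_x (f x)%:E - \int[l2]_x (f x)%:E)%E.
Proof.
move=> mf fM mE.
have int (mu : {finite_measure set (borelX X) -> \bar R}) :
    mu.-integrable [set: borelX X] (EFin \o f).
  exact: (bounded_integrable (fin_measure_lty mu) mf fM).
have fin (mu : {finite_measure set (borelX X) -> \bar R}) :
    (\int[mu]_x (f x)%:E)%E \is a fin_num.
  exact: (integrable_fin_num measurableT (int mu)).
have mf' : measurable_fun [set: borelX X] (EFin \o f) by exact/measurable_EFinP.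
have add (mu1 mu2 : {finite_measure set (borelX X) -> \bar R}) :
    (\int[measure_add mu1 mu2]_x (f x)%:E =
     \int[mu1]_x (f x)%:E + \int[mu2]_x (f x)%:E)%E.
  by apply: integral_measure_add => //; exact: int.
have : (\int[measure_add (jordan_pos NN) l2]_x (f x)%:E =
        \int[measure_add l1 (jordan_neg NN)]_x (f x)%:E)%E.
  apply: eq_measure_integral => A mA _.
  rewrite -[LHS]/(measure_add (jordan_pos NN) l2 A).
  rewrite -[RHS]/(measure_add l1 (jordan_neg NN) A) !measure_addE.
  have := jordan_decomp NN mA; rewrite mE// /cadd/= cscaleN1.
  have [a ->] := fin_numE (fin_num_measure l1 A mA).
  have [b ->] := fin_numE (fin_num_measure l2 A mA).
  have [p ->] := fin_numE (fin_num_measure (jordan_pos NN) A mA).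
  have [n nE] := fin_numE (fin_num_measure (jordan_neg NN) A mA).
  have nE' : jordan_neg NN A = n%:E := nE.
  by rewrite nE nE' -!EFinB -!EFinD => -[ab]; congr EFin; lra.
rewrite !add.
have [a ->] := fin_numE (fin l1); have [b ->] := fin_numE (fin l2).
have [p ->] := fin_numE (fin (jordan_pos NN)); have [n ->] := fin_numE (fin (jordan_neg NN)).
by rewrite -!EFinB -!EFinD => -[ab]; congr EFin; lra.
Qed.

Lemma charge_integralB m (l1 l2 : {finite_measure set (borelX X) -> \bar R}) f M :
  measurable_fun [set: borelX X] f -> (forall x, `|f x| <= M) ->
  (forall A, measurable A -> m A = l1 A - l2 A)%E ->
  (charge_integral m f = \int[l1]_x (f x)%:E - \int[l2]_x (f x)%:E)%E.
Proof. exact: jordan_integralB. Qed.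

(** * Total variation of a charge and its test functions *)

Lemma charge_total_variation_fin m : charge_total_variation m \is a fin_num.
Proof. by rewrite /charge_total_variation /charge_variation /= fin_numD !fin_num_measure. Qed.

Lemma abse_jordan_integral_le m P N (NN : hahn_decomposition m P N) f :
  measurable_fun [set: borelX X] f -> (forall x, `|f x| <= 1) ->
  (`|\int[jordan_pos NN]_x (f x)%:E - \int[jordan_neg NN]_x (f x)%:E|
   <= charge_variation NN [set: borelX X])%E.
Proof.
move=> mf f1; apply: le_trans (lee_abs_sub _ _) _; rewrite /charge_variation /=.
have le1 (mu : {finite_measure set (borelX X) -> \bar R}) :
    (`|\int[mu]_x (f x)%:E| <= mu [set: borelX X])%E.
  apply: le_trans (le_abse_integral _ measurableT _) _; first exact/measurable_EFinP.
  rewrite -[leRHS]mul1e -integral_cst//; apply: ge0_le_integral => //.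
  - by apply: measurableT_comp => //; exact/measurable_EFinP.
  - by move=> x _; rewrite /= lee_fin.
by apply: leeD; exact: le1.
Qed.

Lemma abse_charge_integral_le m f : measurable_fun [set: borelX X] f ->
  (forall x, `|f x| <= 1) -> (`|charge_integral m f| <= charge_total_variation m)%E.
Proof. exact: abse_jordan_integral_le. Qed.

Context {ip : X -> X -> R}.
Hypothesis hip : is_inner_product ip.
Hypothesis hsep : separable X.

(* [1 - 2 chi], with [chi] close to the indicator of the positive part of the Hahn
   decomposition, nearly attains the total variation. *)
Lemma charge_variation_approx m P N (NN : hahn_decomposition m P N) (d : R) : 0 < d ->
  exists phi, [/\ C1b (ip := ip) phi, forall x, `|phi x| <= 1 &
    (charge_variation NN [set: borelX X] <=
     - (\int[jordan_pos NN]_x (phi x)%:E - \int[jordan_neg NN]_x (phi x)%:E) + d%:E)%E].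
Proof.
move=> d0; have [[mP posP] [mN negN] PN PN0] := NN.
pose pos : {finite_measure set (borelX X) -> \bar R} := jordan_pos NN.
pose neg : {finite_measure set (borelX X) -> \bar R} := jordan_neg NN.
pose tau := measure_add pos neg.
have tau_fin : (tau [set: borelX X] < +oo)%E.
  by rewrite /tau measure_addE lte_add_pinfty// ltey_eq fin_num_measure.
(* Approximation in [L^1(tau)] controls the errors for [pos] and [neg] together; it is halved
   because [phi] contains [2 * chi]. *)
have d20 : 0 < d / 2 by rewrite divr_gt0.
have [chi [Cchi chi01 chid]] := C1b_approximation hip hsep tau_fin mP d20.
have negP0 : neg P = 0%E.
  rewrite -[LHS]/(jordan_neg NN P) jordan_negE cjordan_negE /crestr0 mem_set// /crestr PN0 charge0.
  by rewrite oppe0.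
have posN0 : pos N = 0%E.
  rewrite -[LHS]/(jordan_pos NN N) jordan_posE cjordan_posE /crestr0 mem_set// /crestr setIC PN0.
  by rewrite charge0.
(* Close to [-1] on [P] and to [1] on [N], in accordance with the minus sign before the charge
   integral. *)
pose phi x := 1 - 2 * chi x.
have Cphi : C1b (ip := ip) phi by exact: (C1bB hip (C1b_cst hip 1) (C1bZ hip 2 Cchi)).
have phi1 x : `|phi x| <= 1.
  have /andP[c0 c1] := chi01 x; rewrite /phi ler_norml; apply/andP; split; lra.
have mchi : measurable_fun [set: borelX X] chi.
  by apply: continuous_borel_measurable; exact: C1b_continuous Cchi.
have mphi : measurable_fun [set: borelX X] phi.
  by apply: continuous_borel_measurable; exact: C1b_continuous Cphi.
have mind : measurable_fun [set: borelX X] (\1_P : _ -> R) by exact: measurable_indic.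
pose e1 (mu : {finite_measure set (borelX X) -> \bar R}) := \int[mu]_x `|chi x - \1_P x|.
have mdist : measurable_fun [set: borelX X] (fun x => `|chi x - \1_P x|).
  by apply: measurableT_comp => //; exact: measurable_funB.
have bdist x : `|(`|chi x - \1_P x|)| <= 1.
  have /andP[c0 c1] := chi01 x.
  by rewrite normr_id indicE ler_norml; case: (x \in P) => /=; apply/andP; split; lra.
have bchi x : `|chi x| <= 1 by have /andP[c0 c1] := chi01 x; rewrite ger0_norm.
have bind x : `|\1_P x : R| <= 1.
  by rewrite indicE; case: (x \in P); rewrite ?normr1 ?normr0.
have intb mu k : measurable_fun [set: borelX X] k -> (forall x, `|k x : R| <= 1) ->
    (mu : {finite_measure set (borelX X) -> \bar R}).-integrable setT (EFin \o k).
  by move=> mk bk; exact: (bounded_integrable (fin_measure_lty mu) mk bk).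
have chiE (mu : {finite_measure set (borelX X) -> \bar R}) :
    `|\int[mu]_x chi x - fine (mu P)| <= e1 mu.
  have -> : fine (mu P) = \int[mu]_x (\1_P x : R).
    by rewrite /Rintegral integral_indic// setIT.
  rewrite -RintegralB//; [|exact: intb..].
  apply: le_normr_Rintegral => //.
  have := integrableB measurableT (intb mu _ mchi bchi) (intb mu _ mind bind).
  exact: eq_integrable.
have phiE (mu : {finite_measure set (borelX X) -> \bar R}) :
    (\int[mu]_x (phi x)%:E =
     (fine (mu [set: borelX X]) - 2 * \int[mu]_x chi x)%R%:E)%E.
  rewrite -(fineK (integrable_fin_num measurableT (intb mu _ mphi phi1))).
  congr EFin; rewrite -/(Rintegral mu setT phi).
  have ichi := intb mu _ mchi bchi.
  rewrite -RintegralZl// -[fine _]mul1r -Rintegral_cst// -RintegralB//.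
    by apply: (intb mu (cst 1)) => // x; rewrite normr1.
  have := integrableZl measurableT 2 ichi; exact: eq_integrable.
have e1D : e1 pos + e1 neg <= d / 2.
  move: chid; rewrite /L1dist /Rintegral /e1 -fineD; last 2 first.
  - exact: (integrable_fin_num measurableT (intb pos _ mdist bdist)).
  - exact: (integrable_fin_num measurableT (intb neg _ mdist bdist)).
  by rewrite (integral_measure_add measurableT (intb pos _ mdist bdist)
    (intb neg _ mdist bdist)).
exists phi; split => //.
have posPT : pos P = pos [set: borelX X].
  have : (pos (P `|` N) = pos P + pos N)%E := measureU pos mP mN PN0.
  by rewrite PN posN0 adde0 => ->.
suff : (pos [set: borelX X] + neg [set: borelX X] <=
  - (\int[pos]_x (phi x)%:E - \int[neg]_x (phi x)%:E) + d%:E)%E by [].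
rewrite !phiE.
have := chiE pos; have := chiE neg; rewrite negP0 posPT subr0.
have [p ->] := fin_numE (fin_num_measure pos _ (@measurableT _ (borelX X))).
have [n ->] := fin_numE (fin_num_measure neg _ (@measurableT _ (borelX X))).
rewrite -EFinB -EFinN -!EFinD lee_fin !ler_norml => /andP[_ h1] /andP[h2 _].
move: e1D h1 h2; move: (e1 pos) (e1 neg) => a b.
rewrite /=; lra.
Qed.

Lemma charge_total_variation_approx m (d : R) : 0 < d -> exists phi,
  [/\ C1b (ip := ip) phi, forall x, `|phi x| <= 1 &
      (charge_total_variation m <= - charge_integral m phi + d%:E)%E].
Proof. exact: charge_variation_approx. Qed.

End charge.

(** * Functions of bounded variation *)

Section bounded_variation.
Context {R : realType} {X : normedModType R} {ip : X -> X -> R}.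
Hypothesis hip : is_inner_product ip.
Hypothesis hsep : separable X.
Context {nu : {measure set (borelX X) -> \bar R}} {Rop Rstar : X -> X}.
Hypothesis hRstar : forall x y, ip (Rop x) y = ip x (Rstar y).
Context {v : X -> X -> R} {u : X -> R} {z : X}.
Hypothesis hu : nu.-integrable [set: borelX X] (EFin \o u).
Hypothesis huv : nu.-integrable [set: borelX X] (EFin \o (fun x => u x * v z x)).
Notation C1b := (C1b (ip := ip)).
Notation C1b_ge0 := (C1b_ge0 (ip := ip)).

Let D := derivative_functional (nu := nu) (u := u) (h := Rstar z).
Let W (f : X -> R) : R := \int[nu]_x (u x * v z x * f x).

Definition bv_functional f := D f - W f.

Let C1b_meas f : C1b f -> measurable_fun [set: borelX X] f.
Proof. by move=> Cf; apply: continuous_borel_measurable; exact: C1b_continuous Cf. Qed.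

(** The adjoint turns [ip (Rop (g x)) z] into the derivative in the direction [Rstar z], and the
    integral splits as [D - W]. *)
Lemma dstar_integral phi g : C1b_grad ip phi g ->
  (\int[nu]_x (u x * dstar ip Rop v z phi g x)%:E)%E = (bv_functional phi)%:E.
Proof.
move=> Cg; have Cphi : C1b phi by exists g.
have [M M0 b] := C1b_d_bounded hip (Rstar z) Cphi.
have [N Nb] := C1b_bounded Cphi.
have i1 := integrable_weighted hu (C1b_d_measurable hip (Rstar z) Cphi) b.
have i2 := integrable_weighted huv (C1b_meas Cphi) Nb.
rewrite /bv_functional /D /derivative_functional /W -RintegralB//.
rewrite /Rintegral fineK; last first.
  have := integrableB measurableT i1 i2.
  by move=> /(integrable_fin_num measurableT).
apply: eq_integral => x _; congr EFin.
rewrite /dstar hRstar; have [_ /(_ x)[_ ->] _ _] := Cg.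
by rewrite mulrBr mulrA.
Qed.

Lemma W_linear : linear_functional (ip := ip) W.
Proof.
split=> [f g Cf Cg|a f Cf]; rewrite /W.
  have [M1 b1] := C1b_bounded Cf; have [M2 b2] := C1b_bounded Cg.
  exact: (weighted_integralD huv (C1b_meas Cf) b1 (C1b_meas Cg) b2).
have [M b] := C1b_bounded Cf.
exact: (weighted_integralZ huv a (C1b_meas Cf) b).
Qed.

Lemma bv_functional_linear : linear_functional (ip := ip) bv_functional.
Proof.
have [DD DZ] := derivative_functional_linear hip hu (h := Rstar z).
have [WD WZ] := W_linear.
split=> [f g Cf Cg|a f Cf]; rewrite /bv_functional /D.
  by rewrite (DD _ _ Cf Cg) (WD _ _ Cf Cg) opprD addrACA.
by rewrite (DZ _ _ Cf) (WZ _ _ Cf) mulrBr.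
Qed.

Lemma W_le f M : C1b f -> (forall x, `|f x| <= M) ->
  `|W f| <= \int[nu]_x (`|u x * v z x| * `|f x|).
Proof. by move=> Cf fM; exact: (weighted_integral_norm_le huv (C1b_meas Cf) fM). Qed.

Lemma W_bounded : exists C, bounded_functional (ip := ip) W C.
Proof.
exists (\int[nu]_x `|u x * v z x|) => f Cf f1; apply: le_trans (W_le Cf f1) _.
have iw : nu.-integrable [set: borelX X] (EFin \o (fun x => `|u x * v z x|)) :=
  integrable_norm huv.
apply: le_Rintegral => //.
  apply: (integrable_weighted iw (M := 1)).
    by apply: measurableT_comp => //; exact: C1b_meas.
  by move=> x; rewrite normr_id.
by move=> x _; rewrite ler_piMr.
Qed.

(** [W] is already integration against the finite signed measure [u v_z nu], so dominated
    convergence suffices. *)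
Lemma W_tight : tight_functional (ip := ip) W.
Proof.
move=> f vf e e0; have [Cf _ f_lim] := vf.
have [M fM] := C1b_bounded (Cf 0%N).1.
have iw : nu.-integrable [set: borelX X] (EFin \o (fun x => `|u x * v z x|)) :=
  integrable_norm huv.
have mf n : measurable_fun [set: borelX X] (f n) by apply: C1b_meas; case: (Cf n).
have f0 n x : 0 <= f n x by case: (Cf n).
have fnM n x : `|f n x| <= M.
  rewrite ger0_norm//; apply: le_trans (vanishing_sequence_le x vf (leq0n n)) _.
  exact: le_trans (ler_norm _) (fM x).
have : \int[nu]_x (`|u x * v z x| * f n x) @[n --> \oo] --> (0 : R).
  rewrite (_ : 0 = \int[nu]_x (`|u x * v z x| * cst 0 x)); last first.
    by under eq_Rintegral do rewrite mulr0; rewrite Rintegral_cst// mul0r.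
  apply: (weighted_integral_cvg iw mf fnM) => // x.
  apply/cvgrPdist_le => d d0; have [n fn] := f_lim x d d0.
  exists n => // m /= nm; rewrite sub0r normrN ger0_norm//.
  exact: le_trans (vanishing_sequence_le x vf nm) fn.
move=> /cvgrPdist_le/(_ e e0)/filter_ex[n ne]; exists n => t Ct tf.
have tM x : `|t x| <= M by apply: le_trans (tf x) (le_trans (ler_norm _) (fnM n x)).
apply: le_trans (W_le Ct tM) _.
apply: (@le_trans _ _ (\int[nu]_x (`|u x * v z x| * f n x))).
  apply: le_Rintegral => //.
  - apply: (integrable_weighted iw (M := M)).
      by apply: measurableT_comp => //; exact: C1b_meas.
    by move=> x; rewrite normr_id.
  - exact: (integrable_weighted iw (mf n) (fnM n)).
  - by move=> x _; rewrite ler_wpM2l.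
by apply: le_trans ne; rewrite sub0r normrN ler_norm.
Qed.

(** As [W] is bounded, so is [D = bv_functional + W]; the sliding hump then applies to [D]. *)
Lemma bv_functional_tight C : bounded_functional (ip := ip) bv_functional C ->
  tight_functional (ip := ip) bv_functional.
Proof.
move=> bL; have [C' bW] := W_bounded.
have bD : bounded_functional (ip := ip) D (C + C').
  move=> f Cf f1; rewrite (_ : D f = bv_functional f + W f); last by rewrite /bv_functional subrK.
  by apply: le_trans (ler_normD _ _) _; rewrite lerD ?bL ?bW.
move=> f vf e e0; have e20 : 0 < e / 2 by rewrite divr_gt0.
have [n1 H1] := derivative_functional_tight hip hu bD vf e20.
have [n2 H2] := W_tight vf e20.
exists (maxn n1 n2) => t Ct tf; rewrite [leRHS]splitr.
apply: le_trans (ler_normB _ _) _; apply: lerD; [apply: H1 => // x|apply: H2 => // x];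
  apply: le_trans (tf x) _; apply: (vanishing_sequence_le x vf).
  exact: leq_maxl.
exact: leq_maxr.
Qed.

Lemma bv_functional_le_Vz f : C1b f -> (forall x, `|f x| <= 1) ->
  ((bv_functional f)%:E <= Vz ip nu Rop v z u)%E.
Proof.
move=> [g Cg] f1; apply: ereal_sup_ubound; exists f, g; split => //.
by rewrite dstar_integral.
Qed.

(** [Vz] bounds only from above, and the test function [- f] gives the other sign. *)
Lemma bv_functional_bounded : (Vz ip nu Rop v z u < +oo)%E ->
  exists C, bounded_functional (ip := ip) bv_functional C.
Proof.
move=> Vy; exists (fine (Vz ip nu Rop v z u)) => f Cf f1.
have V0 : (0 <= Vz ip nu Rop v z u)%E.
  have := @bv_functional_le_Vz (cst 0) (C1b_cst hip 0).
  rewrite (functional0 hip bv_functional_linear); apply => x.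
  by rewrite normr0.
have Vfin : Vz ip nu Rop v z u \is a fin_num by rewrite ge0_fin_numE.
have HV k : C1b k -> (forall x, `|k x| <= 1) -> bv_functional k <= fine (Vz ip nu Rop v z u).
  by move=> Ck k1; rewrite -lee_fin fineK//; exact: bv_functional_le_Vz.
rewrite ler_norml HV// andbT lerNl -mulN1r -bv_functional_linear.2//.
by apply: HV; [exact: C1bZ|move=> x; rewrite mulN1r normrN].
Qed.

Lemma BVz_measure_exists : (Vz ip nu Rop v z u < +oo)%E ->
  exists m, BVz_measure ip nu Rop v z u m.
Proof.
move=> Vy; have [C bL] := bv_functional_bounded Vy.
have linL := bv_functional_linear.
have [l1 [l2 lE]] := signed_representation hip hsep linL bL (bv_functional_tight bL).
(* The order [l2 - l1] reflects the minus sign in [BVz_measure]. *)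
pose m := cadd (charge_of_finite_measure l2) (copp (charge_of_finite_measure l1)).
exists m => phi g Cg; have Cphi : C1b phi by exists g.
have [M Mb] := C1b_bounded Cphi.
rewrite (charge_integralB (m := m) (l1 := l2) (l2 := l1) (C1b_meas Cphi) Mb); last by [].
rewrite dstar_integral//.
(* The representation is known for nonnegative functions, so it is applied to [phi + c] and to [c],
   and the two are subtracted. *)
pose c := `|M|; have c0 : 0 <= c := normr_ge0 M.
have Cc : C1b_ge0 (cst c) := C1b_ge0_cst hip c0.
have Cpc : C1b_ge0 (phi \+ cst c).
  split; first exact: (C1bD hip Cphi (C1b_cst hip c)).
  move=> x; rewrite /= -lerBlDr sub0r; have := Mb x; rewrite ler_norml => /andP[+ _].
  by apply: le_trans; rewrite lerN2 ler_norm.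
have := lE _ Cpc; have := lE _ Cc; rewrite (linL.1 _ _ Cphi Cc.1).
have fin (l : {finite_measure set (borelX X) -> \bar R}) k B : C1b k ->
    (forall x, `|k x| <= B) -> l.-integrable setT (EFin \o k).
  move=> Ck kB; apply: (bounded_integrable _ (C1b_meas Ck) kB).
  by rewrite ltey_eq fin_num_measure.
have cB (x : X) : `|cst c x : R| <= c by rewrite /= ger0_norm.
have splitE (l : {finite_measure set (borelX X) -> \bar R}) :
    (\int[l]_x ((phi \+ cst c) x)%:E = \int[l]_x (phi x)%:E + \int[l]_x (cst c x)%:E)%E.
  have <- := integralD_EFin measurableT (fin l _ _ Cphi Mb) (fin l _ _ Cc.1 cB).
  by apply: eq_integral => x _; rewrite -EFinD.
rewrite !splitE.
have finE (l : {finite_measure set (borelX X) -> \bar R}) k B : C1b k ->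
    (forall x, `|k x| <= B) -> exists a, (\int[l]_x (k x)%:E)%E = a%:E.
  move=> Ck kB; exists (fine (\int[l]_x (k x)%:E)).
  by rewrite fineK//; exact: (integrable_fin_num measurableT (fin l k B Ck kB)).
have [a1 ->] := finE l1 _ _ Cphi Mb; have [a2 ->] := finE l2 _ _ Cphi Mb.
have [b1 ->] := finE l1 _ _ Cc.1 cB; have [b2 ->] := finE l2 _ _ Cc.1 cB.
rewrite -!EFinB -EFinN => -[h1] [h2]; congr EFin.
by apply: (@addIr _ (b1 - b2)); rewrite -[in LHS]h1 h2 opprB opprD addrACA.
Qed.

(** Nearly extremal test functions for the Hahn decomposition give one inequality; the other bounds
    the integral of any [phi] with [|phi| <= 1] by the total variation. *)
Lemma BVz_measure_total_variation m : BVz_measure ip nu Rop v z u m ->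
  charge_total_variation m = Vz ip nu Rop v z u.
Proof.
move=> hm; apply/eqP; rewrite eq_le; apply/andP; split.
  apply/lee_addgt0Pr => e e0.
  have [phi [[g Cg] phi1 tv]] := charge_total_variation_approx hip hsep m e0.
  apply: le_trans tv _; rewrite -(hm _ _ Cg); apply: leeD2r.
  by apply: ereal_sup_ubound; exists phi, g.
apply: ge_ereal_sup => _ [phi [g [Cg phi1 ->]]]; rewrite (hm _ _ Cg).
have Cphi : C1b phi by exists g.
apply: le_trans (abse_charge_integral_le m (C1b_meas Cphi) phi1).
by rewrite -abseN; exact: lee_abs.
Qed.

End bounded_variation.

Unset Implicit Arguments.
Set Strict Implicit.

Theorem theorem3p3 (R : realType) (X : completeNormedModType R)
  (ip : X -> X -> R) (hip : is_inner_product ip) (hsep : separable X)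
  (nu : probability (borelX X) R)
  (Rop : {linear X -> X}) (hRop : continuous Rop)
  (Rstar : X -> X) (hRstar : forall x y, ip (Rop x) y = ip x (Rstar y))
  (v : X -> X -> R)
  (hvLp : forall z (p : R), 1 < p -> in_Lp nu p (v z))
  (hvIBP : forall z phi g, C1b_grad ip phi g ->
     (\int[nu]_x (ip (Rop (g x)) z)%:E = \int[nu]_x (v z x * phi x)%:E)%E)
  (u : X -> R) (z : X)
  (hu : nu.-integrable [set: borelX X] (fun x => (u x)%:E))
  (hz : Rstar z <> 0)
  (huv : nu.-integrable [set: borelX X] (fun x => (u x * v z x)%:E)) :
  (BVz ip nu Rop v z u <-> (Vz ip nu Rop v z u < +oo)%E) /\
  (forall m : {charge set borelX X -> \bar R},
     BVz_measure ip nu Rop v z u m ->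
     charge_total_variation m = Vz ip nu Rop v z u).
Proof.
split; last by move=> m; exact: (BVz_measure_total_variation hip hsep).
split=> [[_ [_ [m hm]]]|Vy].
  (* A charge has finite values, hence finite total variation, and this equals [Vz]. *)
  rewrite -(BVz_measure_total_variation hip hsep hm) ltey_eq.
  by rewrite charge_total_variation_fin.
by split=> //; split=> //; exact: (BVz_measure_exists hip hsep hRstar hu huv Vy).
Qed.
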